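(* Let $\bar A=(A_0,A_1)$ be a compatible couple of (quasi-)Banach spaces with $A_0\cap A_1\neq\{0\}$. Let $0<\theta_1<1$, $0\le\theta<1$, $0<q_1,r,r_1\le\infty$, $a,a_1,b_1\in SV$, and $\left\|s^{-1/r_1}\frac{b_1(s)}{a_1(s)}\right\|_{r_1,(1,\infty)}<\infty$. If $\theta=0$, assume additionally that $\left\|s^{-1/r}a(s)\right\|_{r,(1,\infty)}<\infty$. Put $c_1(t)=a_1(t)\left\|s^{-1/r_1}\frac{b_1(s)}{a_1(s)}\right\|_{r_1,(t,\infty)}$ and $\rho(t)=t^{\theta_1}\frac{1}{c_1(t)}$ for $t>0$. Then $$\left(A_0,\bar A^{\mathcal L}_{\theta_1,r_1,b_1,q_1,a_1}\right)_{\theta,r,a}\cong\bar A_{\eta,r,a^{\#}},$$ where $\eta=\theta\theta_1$ and $a^{\#}(t)=c_1(t)^{\theta}a(\rho(t))$.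
   Context: For a compatible couple $\bar X=(X_0,X_1)$ of (quasi-)Banach spaces, $f\in X_0+X_1$ and $t>0$, $K(t,f)=K(t,f;\bar X)=\inf\{\|f_0\|_{X_0}+t\|f_1\|_{X_1}: f=f_0+f_1,\ f_i\in X_i\}$. $\|\cdot\|_{q,(c,d)}$ ($0<q\le\infty$) is the usual (quasi-)norm of the Lebesgue space $L_q$ on the interval $(c,d)$ with Lebesgue measure (variable of integration: the displayed variable; $1/\infty=0$). $SV$ is the set of positive Lebesgue measurable functions $b$ on $(0,\infty)$ that are slowly varying: for each $\varepsilon>0$, $t^{\varepsilon}b(t)$ is equivalent to an increasing function and $t^{-\varepsilon}b(t)$ is equivalent to a decreasing function, where two positive functions are equivalent if each is bounded by a constant multiple of the other. For $0\le\theta\le1$, $0<q\le\infty$, $b\in SV$, $\bar X_{\theta,q,b}=(X_0,X_1)_{\theta,q,b}$ is the space of $f\in X_0+X_1$ with $\|f\|=\left\|u^{-\theta-1/q}b(u)K(u,f)\right\|_{q,(0,\infty)}<\infty$. For $0<\sigma<1$, $0<r,q\le\infty$, $a,b\in SV$, $\bar X^{\mathcal L}_{\sigma,r,b,q,a}$ is the space of $f\in X_0+X_1$ with $\|f\|=\left\|t^{-1/r}\frac{b(t)}{a(t)}\left\|u^{-\sigma-1/q}a(u)K(u,f)\right\|_{q,(0,t)}\right\|_{r,(0,\infty)}<\infty$. $X\cong Y$ means that $X$ and $Y$ are continuously embedded in each other (same space, equivalent quasi-norms). *)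

(* Defs.v *)
From HB Require Import structures.
From mathcomp Require Import all_boot all_order all_algebra.
From mathcomp Require Import complex.
From mathcomp Require Import all_classical all_reals all_analysis.
From mathcomp Require Import measurable_realfun.

Set Implicit Arguments.
Unset Strict Implicit.
Unset Printing Implicit Defensive.

Import Order.TTheory GRing.Theory Num.Theory.
Import numFieldNormedType.Exports.

Local Open Scope classical_set_scope.
Local Open Scope ring_scope.

(* Vector spaces are real or complex; quasi-norms take values in R. *)
Inductive scalar_kind := RealScalars | ComplexScalars.

Definition scalar_field (R : realType) (k : scalar_kind) : numFieldType :=
  match k with
  | RealScalars => R : numFieldType
  | ComplexScalars => R[i] : numFieldType
  end.

Definition modulus (R : realType) (k : scalar_kind) : scalar_field R k -> R :=
  match k with
  | RealScalars => fun x : R => `|x|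
  | ComplexScalars => fun z : R[i] => Normc.normc z
  end.

Section quasi_banach_couples.
Context {R : realType} {k : scalar_kind}.
Context {V : topologicalLmodType (scalar_field R k)}.

(* A quasi-normed space inside the ambient space V: only the values of qnorm
   on the carrier are meaningful. *)
Record qspace := QSpace { carrier : set V ; qnorm : V -> R }.

Definition is_quasinormed (X : qspace) : Prop :=
  [/\ [/\ carrier X 0,
          (forall x y, carrier X x -> carrier X y -> carrier X (x + y)) &
          (forall l x, carrier X x -> carrier X (l *: x))],
      (forall x, carrier X x -> 0 <= qnorm X x),
      (forall x, carrier X x -> (qnorm X x = 0 <-> x = 0)),
      (forall l x, carrier X x -> qnorm X (l *: x) = modulus l * qnorm X x) &
      (exists C : R, forall x y, carrier X x -> carrier X y ->
         qnorm X (x + y) <= C * (qnorm X x + qnorm X y))].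

Definition is_complete (X : qspace) : Prop :=
  forall u : nat -> V, (forall n, carrier X (u n)) ->
  (forall e : R, 0 < e -> exists N, forall m n, (N <= m)%N -> (N <= n)%N ->
     qnorm X (u m - u n) < e) ->
  exists2 l, carrier X l &
    forall e : R, 0 < e -> exists N, forall n, (N <= n)%N ->
      qnorm X (u n - l) < e.

Definition is_quasi_banach (X : qspace) : Prop :=
  is_quasinormed X /\ is_complete X.

(* Continuity at 0 of the inclusion in V, hence continuity by linearity. *)
Definition continuously_included (X : qspace) : Prop :=
  forall U : set V, nbhs (0 : V) U ->
  exists2 d : R, 0 < d & forall x, carrier X x -> qnorm X x < d -> U x.

Definition compatible_couple (X0 X1 : qspace) : Prop :=
  [/\ hausdorff_space V,
      is_quasi_banach X0 /\ continuously_included X0 &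
      is_quasi_banach X1 /\ continuously_included X1].

Definition embedded (X Y : qspace) : Prop :=
  carrier X `<=` carrier Y /\
  exists C : R, forall x, carrier X x -> qnorm Y x <= C * qnorm X x.

Definition qspace_equiv (X Y : qspace) : Prop := embedded X Y /\ embedded Y X.

Definition sum_space (X0 X1 : qspace) : set V :=
  [set f | exists f0 f1, [/\ carrier X0 f0, carrier X1 f1 & f = f0 + f1]].

(* Meaningful for f in sum_space X0 X1 only: inf set0 is 0. *)
Definition K_functional (X0 X1 : qspace) (t : R) (f : V) : R :=
  inf [set s | exists f0 f1, [/\ carrier X0 f0, carrier X1 f1, f = f0 + f1 &
                                s = qnorm X0 f0 + t * qnorm X1 f1]].

End quasi_banach_couples.

Arguments qspace {R k} V.

Section slowly_varying.
Context {R : realType}.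
Implicit Types (q : \bar R) (D : set R) (b : R -> R).

(* The source is R with the sigma-algebra of Lebesgue measurable sets (unions of
   a Borel set and a null set), the target is R with the Borel sigma-algebra. *)
Definition lebesgue_measurable_fun D b : Prop :=
  let T := g_sigma_algebraType (completed_algebra_gen (@lebesgue_measure R)) in
  measurable_fun (D : set T) (b : T -> measurableTypeR R).

Definition equivalent_on_pos b g : Prop :=
  exists C : R, forall t, 0 < t -> b t <= C * g t /\ g t <= C * b t.

(* Functions on (0, +oo) are total functions whose values at t <= 0 are
   irrelevant. *)
Definition SV b : Prop :=
  [/\ lebesgue_measurable_fun `]0, +oo[ b,
      (forall t, 0 < t -> 0 < b t) &
      forall e : R, 0 < e ->
        (exists g : R -> R, [/\ (forall t, 0 < t -> 0 < g t),
           (forall s t, 0 < s -> s <= t -> g s <= g t) &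
           equivalent_on_pos (fun t => t `^ e * b t) g]) /\
        (exists g : R -> R, [/\ (forall t, 0 < t -> 0 < g t),
           (forall s t, 0 < s -> s <= t -> g t <= g s) &
           equivalent_on_pos (fun t => t `^ (- e) * b t) g])].

(* 1 / q, with 1 / +oo = 0. *)
Definition recip q : R := fine (q^-1)%E.

(* The L_q (quasi-)norm on D, for 0 < q <= +oo: Lnorm integrates over the whole
   line, so f is extended by 0 outside D. Integrals of nonnegative functions are
   suprema over Borel simple functions, and null sets are the subsets
   of Borel null sets, so on Lebesgue measurable functions this is the usual
   Lebesgue norm although lebesgue_measure lives on the Borel sets. *)
Definition Lq_norm q D (f : R -> \bar R) : \bar R :=
  Lnorm (@lebesgue_measure R) q (f \_ D).

End slowly_varying.

Section interpolation_spaces.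
Context {R : realType} {k : scalar_kind}.
Context {V : topologicalLmodType (scalar_field R k)}.

Definition interp_enorm (X0 X1 : qspace V) (theta : R) (q : \bar R)
    (b : R -> R) (f : V) : \bar R :=
  Lq_norm q `]0, +oo[
    (fun u => (u `^ (- theta - recip q) * b u * K_functional X0 X1 u f)%:E).

Definition interp_space (X0 X1 : qspace V) (theta : R) (q : \bar R)
    (b : R -> R) : qspace V :=
  QSpace [set f | sum_space X0 X1 f /\ (interp_enorm X0 X1 theta q b f < +oo)%E]
         (fun f => fine (interp_enorm X0 X1 theta q b f)).

Definition L_enorm (X0 X1 : qspace V) (sigma : R) (r : \bar R) (b : R -> R)
    (q : \bar R) (a : R -> R) (f : V) : \bar R :=
  Lq_norm r `]0, +oo[ (fun t =>
    ((t `^ (- recip r) * (b t / a t))%:E *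
     Lq_norm q `]0%R, t[ (fun u =>
       (u `^ (- sigma - recip q) * a u * K_functional X0 X1 u f)%:E))%E).

Definition L_space (X0 X1 : qspace V) (sigma : R) (r : \bar R) (b : R -> R)
    (q : \bar R) (a : R -> R) : qspace V :=
  QSpace [set f | sum_space X0 X1 f /\ (L_enorm X0 X1 sigma r b q a f < +oo)%E]
         (fun f => fine (L_enorm X0 X1 sigma r b q a f)).

End interpolation_spaces.

(* Main.v *)
Require Import Defs.
From mathcomp Require Import all_boot all_order all_algebra.
From mathcomp Require Import all_classical all_reals all_analysis.
From mathcomp Require Import measurable_realfun ess_sup_inf ring lra.

Import Order.TTheory GRing.Theory Num.Theory.
Import numFieldNormedType.Exports.

Local Open Scope classical_set_scope.
Local Open Scope ring_scope.

(* Every weight involved is almost constant on intervals of bounded logarithmic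
   length, so an L_q quasi-norm with respect to dt/t is comparable to the l_q
   quasi-norm over int of the values at the points of any grid p whose ratios
   p (n + 1) / p n stay in some [2, L]. Measurability plays no role, the change
   of variables u = rho t amounts to passing from a grid p to the grid rho \o p,
   and for all 0 < q <= +oo Hardy's inequality follows from the elementary fact
   that x_n <= C sup_k e^(-d|k|) y_(n+k) implies |x|_q <= C' |y|_q.

   Write K and K' for the K-functionals of (A0, A1) and (A0, L), where L is the
   space A^L, and w(t) = rho(t)^(-theta) a(rho(t)), so that the target norm is
   that of w K in L_r(dt/t) and the reiterated one is that of w (K' o rho).
   - K(t, f) <= C K'(rho(t), f): if f = g + h then
     K(t, h) <= C rho(t) |h|_L, because the inner norm defining |h|_L is at least
     c t^(-theta1) a1(t) K(t, h) on all of (t, +oo).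
   - If w(u) K(u, f) <= M (u/t)^d for all u >= t, with d small, take a nearly
     optimal decomposition f = f0 + f1 for K(t, f). The function
     u^(-theta1) a1(u) K(u, f1) is then bounded by a peak at t, i.e. by a multiple
     of min(u/t, t/u)^delta, whence w(t) K'(rho(t), f) <= C M. Hardy's inequality
     turns this into the converse norm estimate. *)

(** * Sequences indexed by the integers *)

(** The enumeration 0, -1, 1, -2, 2, ... turns sums over [int] into series over [nat], where scaling
    and interchange of sums are available. *)
Definition zseq (i : nat) : int := if odd i then Negz i./2 else Posz i./2.

Lemma zseq_bij : set_bij [set: nat] [set: int] zseq.
Proof.
split => //.
- move=> i j _ _; rewrite /zseq.
  have ei := odd_double_half i; have ej := odd_double_half j.
  case oi : (odd i); case oj : (odd j) => // -[] ij.
  + by rewrite -ei -ej oi oj ij.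
  + by rewrite -ei -ej oi oj ij.
- move=> [n|n] _.
  + by exists n.*2 => //; rewrite /zseq odd_double doubleK.
  + by exists n.*2.+1 => //; rewrite /zseq /= odd_double /= uphalf_double.
Qed.

Lemma esum_zseq {R : realType} (a : int -> \bar R) : (forall n, 0 <= a n)%E ->
  (\esum_(n in [set: int]) a n = \sum_(i <oo) a (zseq i))%E.
Proof.
by move=> a0; rewrite (reindex_esum _ _ zseq _ zseq_bij) nneseries_esumT.
Qed.

(** Makes a weight that decays exponentially in |n| decay geometrically along the enumeration. *)
Lemma zseq_norm_ge {R : realType} (i : nat) :
  (i%:R / 2 <= `|(zseq i)%:~R| :> R).
Proof.
rewrite /zseq -{1}(odd_double_half i) natrD -muln2 natrM.
case: (odd i).
  rewrite NegzE mulrNz normrN /= ger0_norm ?ler0n// -natr1; lra.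
by rewrite ger0_norm ?ler0n//= /intmul /=; lra.
Qed.

(** No absolute values are taken, because it is applied to nonnegative sequences. Values in the
    extended reals avoid any summability assumption. *)
Definition seq_norm {R : realType} (q : \bar R) (x : int -> R) : \bar R :=
  match q with
  | r%:E => poweR (\esum_(n in [set: int]) (x n `^ r)%:E) r^-1
  | _ => ereal_sup (range (fun n => (x n)%:E))
  end.

Lemma esum_shift {R : realType} (a : int -> \bar R) (k : int) :
  (\esum_(n in [set: int]) a (n + k)%R = \esum_(n in [set: int]) a n)%E.
Proof.
rewrite [RHS](reindex_esum [set: int] _ (fun n => n + k))//.
split => //; first by move=> i j _ _ /addIr.
by move=> i _; exists (i - k) => //; rewrite subrK.
Qed.

Lemma esum_term_le {R : realType} (a : int -> \bar R) k :
  (a k <= \esum_(n in [set: int]) a n)%E.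
Proof.
apply: esum_ge; exists [set k]; first by split => //; exact: finite_set1.
by rewrite fsbig_set1.
Qed.

Lemma seq_norm_ge0 {R : realType} (q : \bar R) (x : int -> R) :
  (0 < q)%E -> (forall n, 0 <= x n) -> (0 <= seq_norm q x)%E.
Proof.
move=> q0 x0; case: q q0 => [r _|_|//] /=; first exact: poweR_ge0.
by apply: (@le_trans _ _ (x 0)%:E); [rewrite lee_fin|apply: ereal_sup_ubound; exists 0].
Qed.

Lemma seq_norm_ge {R : realType} (q : \bar R) (x : int -> R) n :
  (0 < q)%E -> (forall n, 0 <= x n) -> ((x n)%:E <= seq_norm q x)%E.
Proof.
move=> q0 x0; case: q q0 => [r|_|//]; last first.
  by apply: ereal_sup_ubound; exists n.
rewrite lte_fin => r0 /=.
have -> : (x n)%:E = poweR (x n `^ r)%:E r^-1.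
  by rewrite poweR_EFin -powRrM mulfV ?gt_eqF// powRr1.
apply: gt0_ler_poweR.
- by rewrite invr_ge0 ltW.
- by rewrite in_itv /= leey andbT lee_fin powR_ge0.
- by rewrite in_itv /= leey andbT esum_ge0// => m _; rewrite lee_fin powR_ge0.
- exact: (esum_term_le (fun n => (x n `^ r)%:E)).
Qed.

(* The hypothesis reads x n <= C * sup_k e^(-d|k|) * y (n + k), as long as the
   supremum is finite. *)
Lemma seq_norm_hardy {R : realType} (q : \bar R) (d C : R) :
  (0 < q)%E -> 0 < d -> 0 < C ->
  exists2 A : R, 0 < A & forall x y : int -> R,
    (forall n, 0 <= x n) -> (forall n, 0 <= y n) ->
    (forall n M, 0 < M ->
      (forall k : int, expR (- (d * `|k%:~R|)) * y (n + k) <= M) ->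
      x n <= C * M) ->
    (seq_norm q x <= A%:E * seq_norm q y)%E.
Proof.
move=> q0 d0 C0; case: q q0 => [r|_|//]; last first.
  exists C => // x y x0 y0 xy.
  have := @seq_norm_ge0 _ +oo%E y (ltry 0) y0.
  have := @seq_norm_ge _ +oo%E y _ (ltry 0) y0.
  case: (seq_norm _ y) => [S| |] // yS S0; last by rewrite gt0_muley ?leey ?lte_fin.
  rewrite -EFinM; apply: ge_ereal_sup => _ [n _ <-]; rewrite lee_fin.
  (* The hypothesis asks for M > 0 while S may be 0, so it is used with M = S + e/C. *)
  apply/ler_addgt0Pr => e e0; have Ce : 0 < e / C by rewrite divr_gt0.
  rewrite -[e in leRHS](mulVKf (lt0r_neq0 C0)) -mulrDr [_ * e]mulrC.
  apply: xy => [|k]; first by rewrite ltr_wpDl // -lee_fin.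
  apply: (@le_trans _ _ (y (n + k))); last first.
    by rewrite -lee_fin (le_trans (yS _))// lee_fin lerDl ltW.
  by rewrite ler_piMl// expR_le1 oppr_le0 mulr_ge0 ?normr_ge0// ltW.
rewrite lte_fin => r0; have rn0 : r != 0 by rewrite gt_eqF.
(* Since |zseq i| >= i/2, the r-th power of the i-th weight is at most z^i. This explains the factor
   1/2, and [A0] is C^r times the geometric sum. *)
pose z := expR (- (d * r / 2)).
have z01 : 0 < z < 1 by rewrite expR_gt0 expR_lt1 oppr_lt0 divr_gt0// mulr_gt0.
have /andP[z0 z1] := z01.
pose A0 := C `^ r * (1 - z)^-1.
have A00 : 0 < A0 by rewrite mulr_gt0 ?powR_gt0// invr_gt0 subr_gt0.
exists (A0 `^ r^-1); first exact: powR_gt0.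
move=> x y x0 y0 xy /=.
pose w (k : int) : R := expR (- (d * `|k%:~R|)).
have w0 k : 0 < w k by exact: expR_gt0.
set S := (\esum_(n in _) (y n `^ r)%:E)%E.
have S0 : (0 <= S)%E by apply: esum_ge0 => n _; rewrite lee_fin powR_ge0.
(* The supremum of the weighted shifts is replaced by their l_r sum. No triangle inequality is
   involved, so r < 1 needs no separate treatment. *)
have key n : ((x n `^ r)%:E <=
   (C `^ r)%:E * \sum_(i <oo) ((w (zseq i) `^ r)%:E * (y (n + zseq i) `^ r)%:E))%E.
  set T := (\sum_(i <oo) _)%E.
  have t0 i : (0 <= (w (zseq i) `^ r)%:E * (y (n + zseq i) `^ r)%:E)%E.
    by rewrite mule_ge0// lee_fin powR_ge0.
  have T0 : (0 <= T)%E by apply: nneseries_ge0 => i _ _; exact: t0.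
  have termT k : (((w k * y (n + k)) `^ r)%:E <= T)%E.
    rewrite powRM ?(ltW (w0 _))// EFinM /T.
    rewrite -(esum_zseq (fun k => (w k `^ r)%:E * (y (n + k) `^ r)%:E)%E).
      exact: (esum_term_le (fun k => (w k `^ r)%:E * (y (n + k) `^ r)%:E)%E).
    by move=> j; rewrite mule_ge0// lee_fin powR_ge0.
  case: T T0 termT => [T| |] // T0 termT; last first.
    by rewrite gt0_muley ?leey// lte_fin powR_gt0.
  have T0' : 0 <= T by rewrite -lee_fin.
  rewrite -EFinM lee_fin.
  have -> : C `^ r * T = (C * T `^ r^-1) `^ r.
    by rewrite powRM ?powR_ge0 ?(ltW C0)// -powRrM mulVf// powRr1.
  apply: ge0_ler_powR; rewrite ?nnegrE ?(ltW r0)//.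
    by rewrite mulr_ge0 ?(ltW C0)// powR_ge0.
  apply/ler_addgt0Pr => e e0; have Ce : 0 < e / C by rewrite divr_gt0.
  rewrite -[e in leRHS](mulVKf (lt0r_neq0 C0)) -mulrDr [_ * e]mulrC.
  apply: xy => [|k]; first by rewrite ltr_wpDl // powR_ge0.
  apply: (@le_trans _ _ (T `^ r^-1)); last by rewrite lerDl ltW.
  rewrite -/(w k) -[leLHS](powRr1 (mulr_ge0 (ltW (w0 k)) (y0 _))).
  rewrite -(mulfV rn0) powRrM; apply: ge0_ler_powR.
  - by rewrite invr_ge0 ltW.
  - by rewrite nnegrE powR_ge0.
  - by rewrite nnegrE.
  - by rewrite -lee_fin.
have wsum : (\sum_(i <oo) (w (zseq i) `^ r)%:E <= ((1 - z)^-1)%:E)%E.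
  apply: (@le_trans _ _ (\sum_(i <oo) (z ^+ i)%:E)%E).
    apply: lee_nneseries => i _ ; first by rewrite lee_fin powR_ge0.
    rewrite lee_fin /w /z -expRM -expRM_natr ler_expR.
    have := zseq_norm_ge (R:=R) i; set a := `|_|; set b := _%:R => ab.
    rewrite -subr_ge0.
    have -> : - (d * r / 2) * b - - (d * a) * r = d * r * (a - b / 2) by field.
    by rewrite mulr_ge0 ?subr_ge0// mulr_ge0 ?ltW.
  apply: lime_le.
    by apply: is_cvg_nneseries => i _ _; rewrite lee_fin exprn_ge0// ltW.
  apply: nearW => n; rewrite sumEFin lee_fin.
  have := @geometric_le_lim R n 1 z ler01 z0.
  rewrite ger0_norm ?(ltW z0)// mul1r => /(_ z1); apply: le_trans.
  by rewrite /series /=; apply: ler_sum => k _; rewrite mul1r.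
apply: (@le_trans _ _ (poweR (A0%:E * S) r^-1)).
  apply: gt0_ler_poweR.
  - by rewrite invr_ge0 ltW.
  - rewrite in_itv /= leey andbT esum_ge0// => m _; by rewrite lee_fin powR_ge0.
  - by rewrite in_itv /= leey andbT mule_ge0// lee_fin ltW.
  apply: (le_trans (le_esum (fun n _ => key n))).
  rewrite esum_zseq; last first.
    move=> n; rewrite mule_ge0 ?lee_fin ?powR_ge0// nneseries_ge0// => i _ _.
    by rewrite mule_ge0// lee_fin powR_ge0.
  rewrite nneseriesZl; last first.
    move=> n _; rewrite nneseries_ge0// => i _ _.
    by rewrite mule_ge0// lee_fin powR_ge0.
  rewrite EFinM -muleA lee_pmul2l ?lte_fin ?powR_gt0//.
  (* After the interchange, shift invariance turns each inner sum into a weight times S. *)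
  rewrite nneseries_interchange; last first.
    by move=> i j; rewrite mule_ge0// lee_fin powR_ge0.
  have inner j : (\sum_(i <oo) ((w (zseq j) `^ r)%:E * (y (zseq i + zseq j) `^ r)%:E) =
    (w (zseq j) `^ r)%:E * S)%E.
    rewrite nneseriesZl; last by move=> i _; rewrite lee_fin powR_ge0.
    congr (_ * _)%E.
    rewrite -(esum_zseq (fun n => (y (n + zseq j) `^ r)%:E)); last first.
      by move=> n; rewrite lee_fin powR_ge0.
    exact: (esum_shift (fun n => (y n `^ r)%:E)).
  under eq_eseriesr do rewrite inner.
  case: (S) S0 => [s| |] // s0; last first.
    by rewrite [leRHS]gt0_muley ?leey// lte_fin invr_gt0 subr_gt0.
  under eq_eseriesr do rewrite muleC.
  rewrite nneseriesZl; last by move=> i _; rewrite lee_fin powR_ge0.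
  by rewrite [leRHS]muleC lee_wpmul2l.
by rewrite poweRM ?lee_fin ?(ltW A00).
Qed.

(** * Discretisation of Lebesgue norms *)

(** The lower ratio makes each interval at least half as long as its right endpoint, and the upper
    one makes it at most L times its left endpoint. Hence every interval has du/u-mass bounded from
    above and below. *)
Definition grid {R : realType} (L : R) (p : int -> R) : Prop :=
  forall n, [/\ 0 < p n, 2 * p n <= p (n + 1) & p (n + 1) <= L * p n].

Lemma grid_lt {R : realType} (L : R) (p : int -> R) n :
  grid L p -> p n < p (n + 1).
Proof. by move=> /(_ n)[p0 p2 _]; lra. Qed.

Lemma grid_le {R : realType} (L : R) (p : int -> R) m n :
  grid L p -> m <= n -> p m <= p n.
Proof.
move=> gp mn; rewrite -(subrK m n) addrC.
have : 0 <= n - m by rewrite subr_ge0.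
case: (n - m) => // k _; elim: k => [|k IH]; first by rewrite addr0.
by apply: (le_trans IH); rewrite -addn1 PoszD addrA ltW// (grid_lt _ _ _ gp).
Qed.

Lemma grid_inj {R : realType} (L : R) (p : int -> R) m n u :
  grid L p -> p m < u <= p (m + 1) -> p n < u <= p (n + 1) -> m = n.
Proof.
move=> gp /andP[mu um] /andP[nu un]; apply/eqP; rewrite eq_le.
apply/andP; split; rewrite leNgt; apply/negP => h.
- have : p (n + 1) <= p m by apply: (grid_le _ _ _ _ gp); rewrite lezD1.
  by move=> h'; have := le_lt_trans un (le_lt_trans h' mu); rewrite ltxx.
- have : p (m + 1) <= p n by apply: (grid_le _ _ _ _ gp); rewrite lezD1.
  by move=> h'; have := le_lt_trans um (le_lt_trans h' nu); rewrite ltxx.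
Qed.

Lemma grid_locate {R : realType} (L : R) (p : int -> R) u :
  grid L p -> 0 < u -> exists n, p n < u <= p (n + 1).
Proof.
move=> gp u0.
(* Doubling gives exponential growth, but linear growth in both directions suffices for the
   Archimedean property. *)
have up (k : nat) : p 0 * k%:R <= p k.
  have [p0 _ _] := gp 0.
  elim: k => [|k IH]; first by rewrite mulr0 ltW.
  have [pk pk2 _] := gp k; rewrite -addn1 PoszD natrD mulrDr mulr1.
  have : p 0 <= p k by exact: (grid_le _ _ _ _ gp).
  lra.
have dn (k : nat) : p (- k%:Z) * k.+1%:R <= p 0.
  elim: k => [|k IH]; first by rewrite mulr1 oppr0.
  have [pk pk2 _] := gp (- k.+1%:Z).
  have e : - k.+1%:Z + 1 = - k%:Z by rewrite -addn1 PoszD opprD addrNK.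
  rewrite e in pk2; apply: (le_trans _ IH).
  have k1 : 1 <= k.+1%:R :> R by rewrite ler1n.
  rewrite -[k.+2]addn1 natrD; nra.
have [p0 _ _] := gp 0.
have [K1 hK1] : exists k : nat, u <= p k.
  have := archi_boundP (ltW (divr_gt0 u0 p0)); set k := Num.bound _ => h.
  exists k; apply: (le_trans _ (up k)); apply: ltW.
  by rewrite mulrC -ltr_pdivrMr.
have [K2 hK2] : exists k : nat, p (- k%:Z) < u.
  have := archi_boundP (ltW (divr_gt0 p0 u0)); set k := Num.bound _ => h.
  exists k; have := dn k => h2.
  have k0 : 0 < k%:R :> R by apply: le_lt_trans h; rewrite divr_ge0 ?ltW.
  have k1 : p 0 < u * k%:R by rewrite mulrC -ltr_pdivrMr.
  have [pk _ _] := gp (- k%:Z).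
  move: h2; rewrite -natr1; nra.
(* Walk upwards from a grid point below u until u is passed; K1 + K2 steps are enough. *)
have : forall (m : nat) n, p n < u -> u <= p (n + m%:Z) ->
    exists n, p n < u <= p (n + 1).
  elim=> [|m IH] n nu; first by rewrite addr0 => /(lt_le_trans nu); rewrite ltxx.
  move=> um; have [un|un] := leP u (p (n + 1)); first by exists n; rewrite nu.
  by apply: (IH (n + 1) un); rewrite -addrA -PoszD add1n.
move/(_ (K1 + K2)%N (- K2%:Z) hK2); apply.
by rewrite PoszD addrCA addNr addr0.
Qed.

(* Unlike ge0_le_integral, no measurability is required. *)
Lemma le_lower_integral {d} {T : measurableType d} {R : realType}
    (mu : {measure set T -> \bar R}) (f g : T -> \bar R) :
  (forall x, 0 <= f x)%E -> (forall x, f x <= g x)%E ->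
  (\int[mu]_x f x <= \int[mu]_x g x)%E.
Proof.
move=> f0 fg.
have g0 x : (0 <= g x)%E by exact: le_trans (fg x).
rewrite !ge0_integralTE//; apply: le_ereal_sup => _ [h hf <-].
by exists h => // x; exact: le_trans (hf x) (fg x).
Qed.

(** A step function with the values c on the grid intervals, written as a series of indicators so
    that it can be integrated term by term. *)
Definition grid_step {R : realType} (p c : int -> R) (u : R) : \bar R :=
  (\sum_(i <oo) (c (zseq i) * \1_(`]p (zseq i), p (zseq i + 1)]%classic) u)%:E)%E.

Lemma grid_step_ge0 {R : realType} (p c : int -> R) u :
  (forall n, 0 <= c n) -> (0 <= grid_step p c u)%E.
Proof.
move=> c0; apply: nneseries_ge0 => i _ _.
by rewrite lee_fin mulr_ge0// indicE ler0n.
Qed.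

Lemma grid_stepE {R : realType} (L : R) (p c : int -> R) n u :
  grid L p -> (forall n, 0 <= c n) -> p n < u <= p (n + 1) ->
  grid_step p c u = (c n)%:E.
Proof.
move=> gp c0 nu.
have t0 m : (0 <= (c m * \1_(`]p m, p (m + 1)]%classic) u)%:E :> \bar R)%E.
  by rewrite lee_fin mulr_ge0// indicE ler0n.
rewrite /grid_step.
rewrite -(esum_zseq (fun m => (c m * \1_(`]p m, p (m + 1)]%classic) u)%:E)%E)//.
rewrite (esumID [set n])// setTI setTI [X in (_ + X)%E]esum1 => [|m /= mn].
  by rewrite adde0 esum_set1// indicE mem_set ?mulr1//= in_itv.
rewrite indicE memNset ?mulr0//= in_itv /= => mu.
exact: (mn (grid_inj _ _ _ _ _ gp mu nu)).
Qed.

Lemma grid_step0 {R : realType} (L : R) (p c : int -> R) u :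
  grid L p -> u <= 0 -> grid_step p c u = 0%E.
Proof.
move=> gp u0; rewrite /grid_step eseries0// => i _ _.
rewrite indicE memNset ?mulr0//= in_itv /= => /andP[pu _].
by have [p0 _ _] := gp (zseq i); have := lt_trans p0 (lt_le_trans pu u0); rewrite ltxx.
Qed.

Lemma integral_grid_step {R : realType} (L : R) (p c : int -> R) :
  grid L p -> (forall n, 0 <= c n) ->
  (\int[@lebesgue_measure R]_u grid_step p c u =
   \sum_(i <oo) (c (zseq i) * (p (zseq i + 1) - p (zseq i)))%:E)%E.
Proof.
move=> gp c0; rewrite integral_nneseries//; last 2 first.
- move=> i; apply/measurable_EFinP; apply: measurable_funM => //.
- by move=> i x _; rewrite lee_fin mulr_ge0// indicE ler0n.
apply: eq_eseriesr => i _.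
under eq_integral do rewrite EFinM.
rewrite ge0_integralZl_EFin//; last exact/measurable_EFinP.
rewrite integral_indic// setIT [X in (_ * X)%E]lebesgue_measure_itv /= lte_fin.
by rewrite (grid_lt _ _ _ gp) EFinM EFinB.
Qed.

Lemma recip_EFin {R : realType} (r : R) : r != 0 -> recip r%:E = r^-1.
Proof. by move=> r0; rewrite /recip inver (negPf r0). Qed.

Lemma recip_pinfty {R : realType} : recip +oo%E = 0 :> R.
Proof. by rewrite /recip invey. Qed.

(** The function is dominated by a step function with an explicit integral. The constant depends on
    q and L only, so that the same bound serves the half-line, ]0, s[ and ]t, +oo[. *)
Lemma Lq_norm_le_seq {R : realType} (q : \bar R) (L : R) : (0 < q)%E -> 0 < L ->
  exists2 C : R, 0 < C & forall (p : int -> R) (D : set R) (g : R -> \bar R)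
      (x : int -> R),
    grid L p -> D `<=` [set u | 0 < u] -> (forall u, D u -> (0 <= g u)%E) ->
    (forall n, 0 <= x n) ->
    (forall n u, D u -> p n < u <= p (n + 1) ->
       (g u <= (u `^ (- recip q) * x n)%:E)%E) ->
    (Lq_norm q D g <= C%:E * seq_norm q x)%E.
Proof.
move=> q0 L0; case: q q0 => [r|_|//]; last first.
  exists 1 => // p D g x gp D0 g0 x0 gx; rewrite mul1e /Lq_norm unlock.
  case: ifPn => _; last by rewrite (@seq_norm_ge0 _ +oo%E).
  apply/ess_supP; apply: nearW => u /=; rewrite patchE; case: ifPn.
    rewrite inE => Du; rewrite gee0_abs ?g0//.
    have [n nu] := grid_locate _ _ _ gp (D0 _ Du).
    apply: (le_trans (gx _ _ Du nu)); rewrite recip_pinfty oppr0 powRr0 mul1r.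
    by apply: ereal_sup_ubound; exists n.
  by move=> _; rewrite abse0 (@seq_norm_ge0 _ +oo%E).
rewrite lte_fin => r0; have rn0 : r != 0 by rewrite gt_eqF.
exists (L `^ r^-1); first by rewrite powR_gt0.
move=> p D g x gp D0 g0 x0 gx; rewrite /Lq_norm unlock /=.
(* The left endpoint gives the upper bound for 1/u on the interval, whose length is at most L times
   p n; this is the origin of the factor L. *)
pose c n := (p n)^-1 * x n `^ r.
have p0 n : 0 < p n by have [] := gp n.
have c0 n : 0 <= c n by rewrite mulr_ge0 ?powR_ge0// invr_ge0 ltW.
have S0 : (0 <= \esum_(n in [set: int]) (x n `^ r)%:E)%E.
  by apply: esum_ge0 => n _; rewrite lee_fin powR_ge0.
rewrite -poweR_EFin -poweRM ?lee_fin ?(ltW L0)//.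
apply: gt0_ler_poweR.
- by rewrite invr_ge0 ltW.
- by rewrite in_itv /= leey andbT integral_ge0// => u _; rewrite poweR_ge0.
- by rewrite in_itv /= leey andbT mule_ge0// lee_fin ltW.
apply: (@le_trans _ _ (\int[@lebesgue_measure R]_u grid_step p c u)%E).
  apply: le_lower_integral => u; first exact: poweR_ge0.
  rewrite patchE; case: ifPn => [|_]; last first.
    by rewrite abse0 poweR0r// grid_step_ge0.
  rewrite inE => Du; rewrite gee0_abs ?g0//.
  have u0 := D0 _ Du.
  have [n nu] := grid_locate _ _ _ gp u0.
  rewrite (grid_stepE _ _ _ _ _ gp c0 nu).
  have /andP[pu up] := nu.
  apply: (@le_trans _ _ (poweR (u `^ (- recip r%:E) * x n)%:E r)).
    apply: gt0_ler_poweR; rewrite ?in_itv /= ?leey ?andbT ?(ltW r0)//.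
    - exact: g0.
    - by rewrite lee_fin mulr_ge0 ?powR_ge0.
    - exact: gx.
  rewrite poweR_EFin lee_fin powRM ?powR_ge0// recip_EFin// -powRrM mulNr mulVf//.
  by rewrite powR_inv1 ?(ltW u0)// ler_wpM2r ?powR_ge0// lef_pV2 ?posrE// ltW.
rewrite (integral_grid_step _ _ _ gp c0) esum_zseq => [|n]; last first.
  by rewrite lee_fin powR_ge0.
rewrite -nneseriesZl => [|i _]; last by rewrite lee_fin powR_ge0.
apply: lee_nneseries => [i _ _|i _].
  by rewrite lee_fin mulr_ge0// subr_ge0 ltW// (grid_lt _ _ _ gp).
rewrite -EFinM lee_fin /c mulrAC ler_wpM2r ?powR_ge0//.
have [pi _ pL] := gp (zseq i).
rewrite mulrC ler_pdivrMr// ; lra.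
Qed.

(** The condition [D u] is imposed only on intervals with 0 < x n, which allows truncated sequences
    to be compared with norms over a part of the half-line. *)
Lemma seq_le_Lq_norm {R : realType} (q : \bar R) (L : R) : (0 < q)%E ->
  exists2 C : R, 0 < C & forall (p : int -> R) (D : set R) (g : R -> \bar R)
      (x : int -> R),
    grid L p -> (forall n, 0 <= x n) ->
    (forall n u, 0 < x n -> p n < u <= p (n + 1) ->
       D u /\ ((u `^ (- recip q) * x n)%:E <= g u)%E) ->
    (seq_norm q x <= C%:E * Lq_norm q D g)%E.
Proof.
move=> q0; case: q q0 => [r|_|//]; last first.
  exists 1 => // p D g x gp x0 gx; rewrite mul1e /Lq_norm unlock.
  have muT : (0 < @lebesgue_measure R [set: R])%E.
    by rewrite -set_itvNyy lebesgue_measure_itv /= ltry.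
  case: ifPn => [_|/negP[]]; last exact: muT.
  apply: ge_ereal_sup => _ [n _ <-].
  have /predU1P[<-|xn] : (0 == x n) || (0 < x n) by rewrite -le_eqVlt.
    apply: ess_sup_gee; first exact: muT.
    by apply: nearW => u; exact: abse_ge0.
  rewrite leNgt; apply/negP => Ex.
  (* If x n exceeded the essential supremum, the whole n-th interval would lie in a null set,
     although its length is positive. *)
  have : (@lebesgue_measure R).-negligible `]p n, p (n + 1)]%classic.
    apply: negligibleS (ess_sup_ge (@lebesgue_measure R) (abse \o g \_ D)).
    move=> u /=; rewrite in_itv /= => nu.
    have [Du gu] := gx _ _ xn nu.
    rewrite recip_pinfty oppr0 powRr0 mul1r in gu.
    apply/negP; rewrite -ltNge; apply: (lt_le_trans Ex).
    by rewrite patchE mem_set// (le_trans gu)// lee_abs.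
  move=> [N [mN N0 IN]].
  have : (@lebesgue_measure R `]p n, p (n + 1)%R]%classic <= 0)%E.
    by rewrite -N0 le_measure// ?inE//; exact: measurable_itv.
  rewrite lebesgue_measure_itv /= lte_fin (grid_lt _ _ _ gp) -EFinB lee_fin.
  by rewrite subr_le0 leNgt (grid_lt _ _ _ gp).
rewrite lte_fin => r0; have rn0 : r != 0 by rewrite gt_eqF.
exists (2 `^ r^-1); first by rewrite powR_gt0.
move=> p D g x gp x0 gx; rewrite /Lq_norm unlock /=.
(* Now the right endpoint bounds 1/u from below, and the interval is at least half as long as that
   endpoint, hence the factor 2. *)
pose c n := (p (n + 1))^-1 * x n `^ r.
have p0 n : 0 < p n by have [] := gp n.
have c0 n : 0 <= c n by rewrite mulr_ge0 ?powR_ge0// invr_ge0 ltW.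
have S0 : (0 <= \esum_(n in [set: int]) (x n `^ r)%:E)%E.
  by apply: esum_ge0 => n _; rewrite lee_fin powR_ge0.
have I0 : (0 <= \int[@lebesgue_measure R]_u poweR `|(g \_ D) u| r)%E.
  by apply: integral_ge0 => u _; rewrite poweR_ge0.
rewrite -poweR_EFin -poweRM ?lee_fin//.
apply: gt0_ler_poweR.
- by rewrite invr_ge0 ltW.
- by rewrite in_itv /= leey andbT.
- by rewrite in_itv /= leey andbT mule_ge0.
apply: (@le_trans _ _ (2%:E * \int[@lebesgue_measure R]_u grid_step p c u)%E); last first.
  rewrite lee_pmul2l//; apply: le_lower_integral => u; first exact: grid_step_ge0.
  have [u0|u0] := leP u 0; first by rewrite (grid_step0 _ _ _ _ gp)// poweR_ge0.
  have [n nu] := grid_locate _ _ _ gp u0.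
  rewrite (grid_stepE _ _ _ _ _ gp c0 nu).
  have := x0 n; rewrite le_eqVlt => /predU1P[xn|xn].
    by rewrite /c -xn powR0// mulr0 poweR_ge0.
  have [Du gu] := gx _ _ xn nu.
  rewrite patchE mem_set//.
  have /andP[pu up] := nu.
  apply: (@le_trans _ _ (poweR (u `^ (- recip r%:E) * x n)%:E r)); last first.
    apply: gt0_ler_poweR; rewrite ?in_itv /= ?leey ?andbT ?(ltW r0)//.
    - by rewrite lee_fin mulr_ge0 ?powR_ge0.
    - exact: le_trans gu (lee_abs _).
  rewrite poweR_EFin lee_fin powRM ?powR_ge0// recip_EFin// -powRrM mulNr mulVf//.
  by rewrite powR_inv1 ?(ltW u0)// ler_wpM2r ?powR_ge0// lef_pV2 ?posrE.
rewrite (integral_grid_step _ _ _ gp c0) esum_zseq => [|n]; last first.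
  by rewrite lee_fin powR_ge0.
rewrite -nneseriesZl => [|i _]; last first.
  by rewrite lee_fin mulr_ge0// subr_ge0 ltW// (grid_lt _ _ _ gp).
apply: lee_nneseries => [i _ _|i _]; first by rewrite lee_fin powR_ge0.
rewrite -EFinM lee_fin /c.
have [pi p2 pL] := gp (zseq i); have pi1 := p0 (zseq i + 1).
have -> : 2 * ((p (zseq i + 1))^-1 * x (zseq i) `^ r * (p (zseq i + 1) - p (zseq i)))
  = x (zseq i) `^ r * (2 * (p (zseq i + 1) - p (zseq i)) / p (zseq i + 1)) by ring.
rewrite ler_peMr ?powR_ge0// ler_pdivlMr//; lra.
Qed.

(** * Slowly varying weights *)

Lemma powR_expR {R : realType} (t x : R) : 0 < t -> t `^ x = expR (x * ln t).
Proof. by move=> t0; rewrite -{1}(lnK t0) -expRM mulrC. Qed.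

Lemma ln_mul_expR {R : realType} (t x : R) : 0 < t -> ln (t * expR x) = ln t + x.
Proof. by move=> t0; rewrite lnM ?posrE ?expR_gt0// expRK. Qed.

Definition log_dist {R : realType} (s t : R) : R := `|ln t - ln s|.

Lemma log_distC {R : realType} (s t : R) : log_dist s t = log_dist t s.
Proof. exact: distrC. Qed.

Lemma log_dist_ge0 {R : realType} (s t : R) : 0 <= log_dist s t.
Proof. exact: normr_ge0. Qed.

(** A Potter bound, symmetric in s and t. Unlike the monotone equivalents in [SV], it passes at once
    to products, inverses and tail norms. *)
Definition slow {R : realType} (b : R -> R) : Prop :=
  (forall t, 0 < t -> 0 < b t) /\
  forall e : R, 0 < e -> exists2 C : R, 0 < C &
    forall s t, 0 < s -> 0 < t -> b t <= C * expR (e * log_dist s t) * b s.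

(** The increasing equivalent of t^e b limits how much b can fall to the right, the decreasing
    equivalent of t^(-e) b how much it can rise. Each equivalence is used at both points, whence the
    squares. *)
Lemma SV_slow {R : realType} (b : R -> R) : SV b -> slow b.
Proof.
move=> [_ b0 bSV]; split => // e e0.
have [[g [g0 gmono [C hC]]] [h [h0 hmono [D hD]]]] := bSV e e0.
have C0 : 0 < C.
  have [+ _] := hC 1 ltr01; rewrite powR1 mul1r => h1.
  have := lt_le_trans (b0 _ ltr01) h1; by rewrite pmulr_lgt0// g0.
have D0 : 0 < D.
  have [+ _] := hD 1 ltr01; rewrite powR1 mul1r => h1.
  have := lt_le_trans (b0 _ ltr01) h1; by rewrite pmulr_lgt0// h0.
have up s t : 0 < s -> s <= t -> b s <= C ^+ 2 * expR (e * (ln t - ln s)) * b t.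
  move=> s0 st; have t0 := lt_le_trans s0 st.
  have [hs _] := hC s s0; have [_ ht] := hC t t0.
  rewrite mulrBr expRB mulrA -!powR_expR// mulrAC ler_pdivlMr ?powR_gt0//.
  rewrite mulrC (le_trans hs)// expr2 -!mulrA ler_wpM2l ?(ltW C0)//.
  exact: (le_trans (gmono _ _ s0 st)).
have dn s t : 0 < s -> s <= t -> b t <= D ^+ 2 * expR (e * (ln t - ln s)) * b s.
  move=> s0 st; have t0 := lt_le_trans s0 st.
  have [_ hs] := hD s s0; have [ht _] := hD t t0.
  have -> : e * (ln t - ln s) = (- e) * ln s - (- e) * ln t by ring.
  rewrite expRB mulrA -!powR_expR// mulrAC ler_pdivlMr ?powR_gt0//.
  rewrite mulrC (le_trans ht)// expr2 -!mulrA ler_wpM2l ?(ltW D0)//.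
  exact: (le_trans (hmono _ _ s0 st)).
exists (C ^+ 2 + D ^+ 2); first by rewrite addr_gt0// exprn_gt0.
move=> s t s0 t0; rewrite /log_dist; have [st|ts] := leP s t.
- rewrite ger0_norm ?subr_ge0 ?ler_ln ?posrE//; apply: (le_trans (dn _ _ s0 st)).
  by rewrite -[leLHS]mulrA -[leRHS]mulrA ler_wpM2r ?lerDr ?exprn_ge0 ?(ltW C0)//
    mulr_ge0 ?expR_ge0// ltW// b0.
- rewrite distrC ger0_norm ?subr_ge0 ?ler_ln ?posrE ?(ltW ts)//.
  apply: (le_trans (up _ _ t0 (ltW ts))).
  by rewrite -[leLHS]mulrA -[leRHS]mulrA ler_wpM2r ?lerDl ?exprn_ge0 ?(ltW D0)//
    mulr_ge0 ?expR_ge0// ltW// b0.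
Qed.

Lemma slow_mul {R : realType} (a b : R -> R) :
  slow a -> slow b -> slow (fun t => a t * b t).
Proof.
move=> [a0 aS] [b0 bS]; split => [t t0|e e0]; first by rewrite mulr_gt0 ?a0 ?b0.
have e20 : 0 < e / 2 by rewrite divr_gt0.
have [C C0 hC] := aS _ e20; have [D D0 hD] := bS _ e20.
exists (C * D); first exact: mulr_gt0.
move=> s t s0 t0.
rewrite [e in expR (e * _)](splitr e) mulrDl expRD.
set E := expR _.
have -> : C * D * (E * E) * (a s * b s) = (C * E * a s) * (D * E * b s) by ring.
by apply: ler_pM; [rewrite ltW// a0|rewrite ltW// b0|exact: hC|exact: hD].
Qed.

Lemma slow_inv {R : realType} (b : R -> R) : slow b -> slow (fun t => (b t)^-1).
Proof.
move=> [b0 bS]; split => [t t0|e e0]; first by rewrite invr_gt0 b0.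
have [C C0 hC] := bS _ e0; exists C => // s t s0 t0.
rewrite ler_pdivlMr ?b0// mulrC ler_pdivrMr ?b0// log_distC; exact: hC.
Qed.

(** A large-scale Lipschitz bound for ln F as a function of ln t, phrased so that F may vanish. C
    and k are explicit because later constants must be uniform in F. *)
Definition log_lip {R : realType} (C k : R) (F : R -> R) : Prop :=
  (forall t, 0 < t -> 0 <= F t) /\
  forall s t, 0 < s -> 0 < t -> F t <= C * expR (k * log_dist s t) * F s.

(** The L_q quasi-norm with respect to du/u. *)
Definition dlog_norm {R : realType} (q : \bar R) (F : R -> R) : \bar R :=
  Lq_norm q `]0, +oo[ (fun u => (u `^ (- recip q) * F u)%:E).

Lemma grid_log_dist {R : realType} (L : R) (p : int -> R) n u :
  grid L p -> p n < u <= p (n + 1) -> log_dist (p n) u <= ln L.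
Proof.
move=> gp /andP[pu up]; have [p0 p2 pL] := gp n.
have u0 := lt_trans p0 pu.
have L0 : 0 < L by rewrite -(pmulr_lgt0 _ p0) (lt_le_trans u0)// (le_trans up).
rewrite /log_dist ger0_norm ?subr_ge0 ?ler_ln ?posrE ?(ltW pu)//.
rewrite lerBlDr -lnM ?posrE// ler_ln ?posrE ?mulr_gt0// (le_trans up)//.
Qed.

Lemma seq_norm_le {R : realType} (q : \bar R) (C : R) : (0 < q)%E -> 0 < C ->
  exists2 A : R, 0 < A & forall x y : int -> R,
    (forall n, 0 <= x n) -> (forall n, 0 <= y n) ->
    (forall n, x n <= C * y n) -> (seq_norm q x <= A%:E * seq_norm q y)%E.
Proof.
move=> q0 C0; have [A A0 hA] := seq_norm_hardy q 1 C q0 ltr01 C0.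
exists A => // x y x0 y0 xy; apply: hA => // n M M0 /(_ 0).
rewrite normr0 mulr0 oppr0 expR0 mul1r addr0 => yM.
by rewrite (le_trans (xy n))// ler_wpM2l// ltW.
Qed.

(** Across one grid interval F changes at most by the factor [D]. The constant serves all grids with
    ratios at most L at once, which permits a grid to be replaced by its image under rho. *)
Lemma dlog_norm_disc {R : realType} (q : \bar R) (C k L : R) :
  (0 < q)%E -> 0 < C -> 0 < k -> 1 < L ->
  exists2 A : R, 0 < A & forall p F, grid L p -> log_lip C k F ->
    (dlog_norm q F <= A%:E * seq_norm q (F \o p))%E /\
    (seq_norm q (F \o p) <= A%:E * dlog_norm q F)%E.
Proof.
move=> q0 C0 k0 L1; have L0 : 0 < L by exact: lt_trans L1.
pose D := C * expR (k * ln L).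
have D0 : 0 < D by rewrite mulr_gt0// expR_gt0.
have [A1 A10 h1] := Lq_norm_le_seq q L q0 L0.
have [A2 A20 h2] := seq_le_Lq_norm q L q0.
have [A3 A30 h3] := seq_norm_le q D q0 D0.
exists (A1 * A3 + A3 * A2); first by rewrite addr_gt0// mulr_gt0.
move=> p F gp [F0 hF].
have p0 n : 0 < p n by have [] := gp n.
have Dle n u : p n < u <= p (n + 1) -> F u <= D * F (p n) /\ F (p n) <= D * F u.
  move=> nu; have u0 : 0 < u by apply: lt_trans (p0 n) _; have /andP[] := nu.
  have E : expR (k * log_dist (p n) u) <= expR (k * ln L).
    by rewrite ler_expR ler_pM2l// (grid_log_dist _ _ _ _ gp nu).
  split.
    apply: (le_trans (hF _ _ (p0 n) u0)).
    by rewrite ler_wpM2r ?F0// ler_wpM2l// ltW.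
  apply: (le_trans (hF _ _ u0 (p0 n))).
  by rewrite ler_wpM2r ?F0// ler_wpM2l ?(ltW C0)// log_distC.
have Fp0 n : 0 <= (F \o p) n by rewrite /= F0.
have N0 : (0 <= seq_norm q (F \o p))%E by exact: seq_norm_ge0.
have P0 : (0 <= dlog_norm q F)%E by exact: Lnorm_ge0.
split.
- apply: (@le_trans _ _ (A1%:E * seq_norm q (fun n => (D * F (p n))%R))%E).
    apply: (h1 p) => //.
    + by move=> u /=; rewrite in_itv /= andbT.
    + move=> u /=; rewrite in_itv /= andbT => u0.
      by rewrite lee_fin mulr_ge0 ?powR_ge0// F0.
    + by move=> n; rewrite mulr_ge0 ?(ltW D0)//; exact: Fp0.
    + move=> n u _ nu; rewrite lee_fin ler_wpM2l ?powR_ge0//.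
      by have [] := Dle n u nu.
  apply: (@le_trans _ _ (A1%:E * (A3%:E * seq_norm q (F \o p)))%E).
    rewrite lee_pmul2l//; apply: h3 => // n.
    by rewrite mulr_ge0 ?(ltW D0)//; exact: Fp0.
  rewrite muleA -EFinM lee_wpmul2r// lee_fin lerDl mulr_ge0// ltW//.
- apply: (@le_trans _ _ (A3%:E * seq_norm q (fun n => (D^-1 * F (p n))%R))%E).
    apply: h3 => // n; first by rewrite mulr_ge0 ?invr_ge0 ?(ltW D0)//; exact: Fp0.
    by rewrite mulVKf// gt_eqF.
  apply: (@le_trans _ _ (A3%:E * (A2%:E * dlog_norm q F))%E).
    rewrite lee_pmul2l//; apply: (h2 p) => // [n|n u _ nu].
      by rewrite mulr_ge0 ?invr_ge0 ?(ltW D0)//; exact: Fp0.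
    have u0 : 0 < u by apply: lt_trans (p0 n) _; have /andP[] := nu.
    rewrite /= in_itv /= andbT u0; split => //.
    rewrite lee_fin ler_wpM2l ?powR_ge0// ler_pdivrMl//.
    by have [] := Dle n u nu.
  by rewrite muleA -EFinM lee_wpmul2r// lee_fin lerDr mulr_ge0// ltW.
Qed.

Definition log_grid {R : realType} (t l : R) (n : int) : R := t * expR (l * n%:~R).

Lemma expR_ge2 {R : realType} (l : R) : 1 <= l -> 2 <= expR l.
Proof. by move=> l1; have := expR_ge1Dx l; apply: le_trans; lra. Qed.

Lemma log_grid_gt0 {R : realType} (t l : R) n : 0 < t -> 0 < log_grid t l n.
Proof. by move=> t0; rewrite mulr_gt0// expR_gt0. Qed.

Lemma ln_log_grid {R : realType} (t l : R) n : 0 < t ->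
  ln (log_grid t l n) = ln t + l * n%:~R.
Proof. exact: ln_mul_expR. Qed.

Lemma log_grid_grid {R : realType} (t l : R) : 0 < t -> 1 <= l ->
  grid (expR l) (log_grid t l).
Proof.
move=> t0 l1 n; have g0 := log_grid_gt0 t l n t0.
have e : log_grid t l (n + 1) = expR l * log_grid t l n.
  by rewrite /log_grid intrD mulrDr expRD mulr1; ring.
split => //; last by rewrite e.
by rewrite e ler_pM2r// expR_ge2.
Qed.

(** In logarithmic coordinates rho has slope between k1 and k2 up to the error c. This controls rho
    on a coarse scale only, so changes of variables are made on grids and not inside integrals. *)
Definition quasi_power {R : realType} (c k1 k2 : R) (rho : R -> R) : Prop :=
  (forall t, 0 < t -> 0 < rho t) /\
  forall s t, 0 < s -> s <= t ->
    k1 * (ln t - ln s) - c <= ln (rho t) - ln (rho s) <= k2 * (ln t - ln s) + c.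

(** The mesh l satisfies l >= 1 and k1 l - c >= 1, so rho grows at least by the factor e >= 2 at
    every step. *)
Lemma quasi_power_grid {R : realType} (c k1 k2 : R) (rho : R -> R) :
  0 < c -> 0 < k1 -> quasi_power c k1 k2 rho ->
  let l := (c + 1) / k1 + 1 in
  grid (expR (k2 * l + c)) (rho \o log_grid 1 l).
Proof.
move=> c0 k10 [rho0 hrho] l n /=.
have l1 : 1 <= l by rewrite lerDr divr_ge0// ltW// addr_gt0.
have s0 := log_grid_gt0 1 l n ltr01; have t0 := log_grid_gt0 1 l (n + 1) ltr01.
have st : log_grid 1 l n <= log_grid 1 l (n + 1).
  by have [_ + _] := log_grid_grid 1 l ltr01 l1 n; apply: le_trans; lra.
have := hrho _ _ s0 st.
have -> : ln (log_grid 1 l (n + 1)) - ln (log_grid 1 l n) = l.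
  by rewrite !ln_log_grid// intrD; ring.
have r0 := rho0 _ s0; have r1 := rho0 _ t0.
have k1l : k1 * l = c + 1 + k1.
  by rewrite mulrDr mulrCA mulfV ?gt_eqF// !mulr1.
move=> /andP[h1 h2]; split => //.
- rewrite -ler_ln ?posrE ?mulr_gt0// lnM ?posrE//.
  have : ln (2 : R) <= ln (expR 1) by rewrite ler_ln ?posrE ?expR_gt0 ?expR_ge2.
  by rewrite expRK; lra.
- rewrite -ler_ln ?posrE ?mulr_gt0 ?expR_gt0// lnM ?posrE ?expR_gt0// expRK; lra.
Qed.

(** The change of variables u = rho t: G is discretised on a log grid, F on the image of that grid,
    and the pointwise hypothesis is applied at the grid points. *)
Lemma dlog_norm_le_comp {R : realType} (q : \bar R) (C k D c k1 k2 : R) :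
  (0 < q)%E -> 0 < C -> 0 < k -> 0 < D -> 0 < c -> 0 < k1 -> 0 < k2 ->
  exists2 A : R, 0 < A & forall rho F G, quasi_power c k1 k2 rho ->
    log_lip C k F -> log_lip C k G ->
    (forall t, 0 < t -> G t <= D * F (rho t)) ->
    (dlog_norm q G <= A%:E * dlog_norm q F)%E.
Proof.
move=> q0 C0 k0 D0 c0 k10 k20.
pose l := (c + 1) / k1 + 1.
have l1 : 1 <= l by rewrite lerDr divr_ge0// ltW// addr_gt0.
have [A A0 hA] := dlog_norm_disc q C k (expR l) q0 C0 k0
  (lt_le_trans (ltr1n _ 2) (expR_ge2 l l1)).
have L1 : 1 < expR (k2 * l + c).
  by rewrite expR_gt1 addr_gt0// mulr_gt0// (lt_le_trans ltr01).
have [B B0 hB] := dlog_norm_disc q C k _ q0 C0 k0 L1.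
have [E E0 hE] := seq_norm_le q D q0 D0.
exists (A * (E * B)); first by rewrite !mulr_gt0.
move=> rho F G hrho hF hG GF.
have gp := quasi_power_grid _ _ _ _ c0 k10 hrho.
have [h1 _] := hA _ _ (log_grid_grid 1 l ltr01 l1) hG.
have [_ h2] := hB _ _ gp hF.
have [rho0 _] := hrho.
apply: (le_trans h1); rewrite EFinM -muleA lee_pmul2l//.
apply: (@le_trans _ _ (E%:E * seq_norm q (F \o (rho \o log_grid 1 l)))%E).
  apply: hE => n /=; first by have [+ _] := hG; apply; exact: log_grid_gt0.
    by have [+ _] := hF; apply; apply: rho0; exact: log_grid_gt0.
  by apply: GF; exact: log_grid_gt0.
by rewrite EFinM -muleA lee_pmul2l.
Qed.

(* Hardy's inequality; the hypothesis reads
   F (rho t) <= D * sup_(u >= t) (t / u)^d * G u, as long as the supremum is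
   finite. *)
Lemma dlog_norm_hardy {R : realType} (q : \bar R) (C k D c k1 k2 d : R) :
  (0 < q)%E -> 0 < C -> 0 < k -> 0 < D -> 0 < c -> 0 < k1 -> 0 < k2 -> 0 < d ->
  exists2 A : R, 0 < A & forall rho F G, quasi_power c k1 k2 rho ->
    log_lip C k F -> log_lip C k G ->
    (forall t M, 0 < t -> 0 < M ->
      (forall u, t <= u -> expR (- (d * (ln u - ln t))) * G u <= M) ->
      F (rho t) <= D * M) ->
    (dlog_norm q F <= A%:E * dlog_norm q G)%E.
Proof.
move=> q0 C0 k0 D0 c0 k10 k20 d0.
pose l := (c + 1) / k1 + 1.
have l1 : 1 <= l by rewrite lerDr divr_ge0// ltW// addr_gt0.
have l0 : 0 < l by exact: lt_le_trans l1.
have [A A0 hA] := dlog_norm_disc q C k (expR l) q0 C0 k0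
  (lt_le_trans (ltr1n _ 2) (expR_ge2 l l1)).
have L1 : 1 < expR (k2 * l + c) by rewrite expR_gt1 addr_gt0// mulr_gt0.
have [B B0 hB] := dlog_norm_disc q C k _ q0 C0 k0 L1.
(* Price of moving u to the next grid point: C e^(kl) for the value of G and e^(dl) for the
   weight. *)
pose M0 := C * expR (k * l) * expR (d * l).
have M00 : 0 < M0 by rewrite !mulr_gt0 ?expR_gt0.
have [E E0 hE] := seq_norm_hardy q (d * l) (D * M0) q0 (mulr_gt0 d0 l0) (mulr_gt0 D0 M00).
exists (B * (E * A)); first by rewrite !mulr_gt0.
move=> rho F G hrho hF hG FG.
have gp := quasi_power_grid _ _ _ _ c0 k10 hrho.
have gg := log_grid_grid 1 l ltr01 l1.
have g0 n := log_grid_gt0 1 l n ltr01.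
have [_ h1] := hA _ _ gg hG.
have [h2 _] := hB _ _ gp hF.
have [rho0 _] := hrho.
apply: (le_trans h2); rewrite EFinM -muleA lee_pmul2l//.
apply: (@le_trans _ _ (E%:E * seq_norm q (G \o log_grid 1 l))%E); last first.
  by rewrite EFinM -muleA lee_pmul2l.
have [G0 hG'] := hG; have [F0 _] := hF.
apply: hE => [n|n|n M M1 hM] /=.
- by apply: F0; exact: rho0.
- exact: G0.
rewrite -mulrA; apply: FG => //; first by rewrite mulr_gt0.
move=> u tu; have u0 := lt_le_trans (g0 n) tu.
have [m mu] := grid_locate _ _ _ gg u0.
have /andP[gmu ugm] := mu.
have nm : n <= m + 1.
  rewrite leNgt; apply/negP => h.
  have : log_grid 1 l (m + 1) < log_grid 1 l n.
    by apply: (lt_le_trans (grid_lt _ _ _ gg)); apply: (grid_le _ _ _ _ gg);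
      rewrite lezD1.
  by rewrite ltNge (le_trans tu ugm).
have := hM (m + 1 - n).
have -> /= : n + (m + 1 - n) = m + 1 by rewrite addrC subrK.
rewrite ger0_norm; last by rewrite ler0z subr_ge0.
move=> h.
have Gu : G u <= C * expR (k * l) * G (log_grid 1 l (m + 1)).
  apply: (le_trans (hG' _ _ (g0 (m + 1)) u0)).
  rewrite ler_wpM2r ?G0// ler_pM2l// ler_expR ler_pM2l// /log_dist.
  rewrite distrC ger0_norm ?subr_ge0 ?ler_ln ?posrE//.
  move: gmu; rewrite -ltr_ln ?posrE// !ln_log_grid// intrD; lra.
apply: (@le_trans _ _ (expR (- (d * (ln u - ln (log_grid 1 l n)))) *
   (C * expR (k * l) * (M * expR (d * l * (m + 1 - n)%:~R))))).
  rewrite ler_wpM2l ?expR_ge0// (le_trans Gu)// ler_wpM2l//.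
    by rewrite mulr_ge0 ?expR_ge0// ltW.
  rewrite -ler_pdivrMr ?expR_gt0// mulrC -expRN.
  by move: h; congr (_ <= _); congr (_ * _); congr (expR (- _)); ring.
set E1 := expR (k * l); set X := expR (d * l * _); set Y := expR (- _).
have -> : Y * (C * E1 * (M * X)) = C * E1 * M * (Y * X) by ring.
have -> : M0 * M = C * E1 * M * expR (d * l) by rewrite /M0 -/E1; ring.
rewrite ler_pM2l ?mulr_gt0 ?expR_gt0// /X /Y -expRD ler_expR.
move: gmu; rewrite -ltr_ln ?posrE// !ln_log_grid// => gmu.
rewrite intrB intrD -subr_ge0.
have -> : d * l - (- (d * (ln u - (ln 1 + l * n%:~R))) + d * l * (m%:~R + 1 - n%:~R))
  = d * (ln u - (ln 1 + l * m%:~R)) by ring.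
by rewrite mulr_ge0 ?(ltW d0)// subr_ge0 ltW.
Qed.

Lemma seq_normZ {R : realType} (q : \bar R) (Z : R) (x : int -> R) :
  (0 < q)%E -> 0 < Z -> (forall n, 0 <= x n) ->
  seq_norm q (fun n => Z * x n) = (Z%:E * seq_norm q x)%E.
Proof.
move=> q0 Z0 x0.
(* One inequality for all factors is enough: the reverse one is the case of Z^-1 and Z x. *)
suff le W y : 0 < W -> (forall n, 0 <= y n) ->
    (seq_norm q (fun n => (W * y n)%R) <= W%:E * seq_norm q y)%E.
  apply/eqP; rewrite eq_le le//= -lee_pdivlMl//.
  have := le Z^-1 (fun n => Z * x n).
  under [X in seq_norm q X]eq_fun do rewrite mulKf ?gt_eqF//.
  by apply; rewrite ?invr_gt0// => n; rewrite mulr_ge0// ltW.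
move=> W0 y0; case: q q0 => [r|_|//] /=.
  rewrite lte_fin => r0.
  under eq_esum do rewrite powRM ?(ltW W0)// EFinM.
  rewrite esum_zseq; last by move=> n; rewrite mule_ge0// lee_fin powR_ge0.
  rewrite nneseriesZl; last by move=> n _; rewrite lee_fin powR_ge0.
  rewrite -(esum_zseq (fun n => (y n `^ r)%:E)); last first.
    by move=> n; rewrite lee_fin powR_ge0.
  rewrite poweRM ?lee_fin ?powR_ge0//; last first.
    by rewrite esum_ge0// => n _; rewrite lee_fin powR_ge0.
  by rewrite poweR_EFin -powRrM mulfV ?gt_eqF// powRr1// ltW.
apply: ge_ereal_sup => _ [n _ <-]; rewrite EFinM lee_pmul2l//.
by apply: ereal_sup_ubound; exists n.
Qed.

(** * Norms of truncated weights *)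

(** Input for [seq_norm_hardy]: the weighted supremum over its shifts is e^(-d|n|), so the norm of a
    discrete peak comes for free. *)
Definition unit_seq {R : realType} (n : int) : R := if n == 0 then 1 else 0.

Lemma seq_norm_unit {R : realType} (q : \bar R) : (0 < q)%E ->
  (seq_norm q (@unit_seq R) <= 1)%E.
Proof.
rewrite /unit_seq.
case: q => [r|_|//] /=.
  rewrite lte_fin => r0; have rn0 : r != 0 by rewrite gt_eqF.
  rewrite (esumID [set 0])// => [|n _]; last by rewrite lee_fin powR_ge0.
  rewrite setTI setTI [X in (_ + X)%E]esum1 => [|m /= mn].
    by rewrite adde0 esum_set1 ?eqxx powR1// poweR1r.
  by rewrite (introF eqP mn) powR0.
by apply: ge_ereal_sup => _ [n _ <-]; rewrite lee_fin; case: ifP; rewrite ?ler01.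
Qed.

(** The loss of 1 occurs for n < 0, where u may be the end of its interval nearer to t. *)
Lemma log_dist_grid {R : realType} (t u : R) (n : int) : 0 < t -> 0 < u ->
  log_grid t 1 n < u <= log_grid t 1 (n + 1) -> `|n%:~R| - 1 <= log_dist t u.
Proof.
move=> t0 u0; have g0 m := log_grid_gt0 t 1 m t0.
move=> /andP[nu un].
have h1 : ln t + n%:~R < ln u.
  by rewrite -[n%:~R]mul1r -ln_log_grid// ltr_ln ?posrE.
have h2 : ln u <= ln t + (n%:~R + 1).
  have -> : n%:~R + 1 = 1 * (n + 1)%:~R :> R by rewrite mul1r intrD.
  by rewrite -ln_log_grid// ler_ln ?posrE.
rewrite /log_dist; move: h1 h2.
set x : R := n%:~R; set y := ln u; set z := ln t => h1 h2.
by case: (ger0P x) => x0; case: (ger0P (y - z)) => yz; lra.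
Qed.

(** The log grid starts at the peak m. The constant depends on neither m nor D, so the peak can be
    moved to an endpoint of D. *)
Lemma Lq_norm_peak {R : realType} (q : \bar R) (d : R) : (0 < q)%E -> 0 < d ->
  exists2 A : R, 0 < A & forall (D : set R) (g : R -> \bar R) (m Z : R),
    0 < m -> 0 < Z -> D `<=` [set u | 0 < u] ->
    (forall u, D u -> (0 <= g u)%E) ->
    (forall u, D u ->
      (g u <= (u `^ (- recip q) * (Z * expR (- (d * log_dist m u))))%:E)%E) ->
    (Lq_norm q D g <= (A * Z)%:E)%E.
Proof.
move=> q0 d0.
have [A A0 hA] := Lq_norm_le_seq q (expR 1) q0 (expR_gt0 1).
have [E E0 hE] := seq_norm_hardy q d (expR d) q0 d0 (expR_gt0 d).
exists (A * E); first exact: mulr_gt0.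
move=> D g m Z m0 Z0 Dpos g0 gZ.
(* The factor e^d makes up for the loss of 1 in [log_dist_grid]. *)
pose x (n : int) : R := expR d * expR (- (d * `|n%:~R|)).
have x0 n : 0 <= x n by rewrite mulr_ge0 ?expR_ge0.
have Zx0 n : 0 <= Z * x n by rewrite mulr_ge0// ltW.
apply: (le_trans (hA _ _ _ _ (log_grid_grid m 1 m0 (lexx 1)) Dpos g0 Zx0 _)).
  move=> n u Du nu; apply: (le_trans (gZ _ Du)); rewrite lee_fin.
  rewrite ler_wpM2l ?powR_ge0// ler_pM2l// /x -expRD ler_expR.
  have := log_dist_grid _ _ _ m0 (Dpos _ Du) nu.
  rewrite -subr_ge0 => h; rewrite -subr_ge0.
  have -> : d - d * `|n%:~R| - - (d * log_dist m u) =
    d * (log_dist m u - (`|n%:~R| - 1)) by ring.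
  by rewrite mulr_ge0// ltW.
rewrite seq_normZ// EFinM EFinM -!muleA lee_pmul2l// muleC.
rewrite lee_pmul2r//.
have -> : E%:E = (E%:E * 1)%E by rewrite mule1.
apply: (@le_trans _ _ (E%:E * seq_norm q unit_seq)%E).
  apply: hE => // [n|n M M0 h]; first by rewrite /unit_seq; case: ifP.
  have := h (- n); rewrite addrN /unit_seq eqxx mulr1 mulrNz normrN => h'.
  by rewrite /x ler_pM2l ?expR_gt0.
by rewrite lee_pmul2l// seq_norm_unit.
Qed.

(** For beta = b1 / a1 this is c1 / a1, as an extended real. *)
Definition tail_norm {R : realType} (q : \bar R) (beta : R -> R) (t : R) : \bar R :=
  Lq_norm q `]t, +oo[ (fun s => (s `^ (- recip q) * beta s)%:E).

(** The grid starts at t, so truncation to ]t, +oo[ keeps exactly the indices n >= 0. *)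
Definition tail_seq {R : realType} (beta : R -> R) (t : R) (n : int) : R :=
  if 0 <= n then beta (log_grid t 1 n) else 0.

Lemma tail_seq_ge0 {R : realType} (beta : R -> R) (t : R) (n : int) :
  slow beta -> 0 < t -> 0 <= tail_seq beta t n.
Proof.
move=> [b0 _] t0; rewrite /tail_seq; case: ifP => // _.
by rewrite ltW// b0// log_grid_gt0.
Qed.

Lemma tail_norm_disc {R : realType} (q : \bar R) (beta : R -> R) :
  (0 < q)%E -> slow beta -> exists2 A : R, 0 < A & forall t, 0 < t ->
    (tail_norm q beta t <= A%:E * seq_norm q (tail_seq beta t))%E /\
    (seq_norm q (tail_seq beta t) <= A%:E * tail_norm q beta t)%E.
Proof.
move=> q0 hb; have [b0 bS] := hb.
have [C C0 hC] := bS _ ltr01.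
pose D := C * expR 1; have D0 : 0 < D by rewrite mulr_gt0// expR_gt0.
have [A1 A10 h1] := Lq_norm_le_seq q (expR 1) q0 (expR_gt0 1).
have [A2 A20 h2] := seq_le_Lq_norm q (expR 1) q0.
exists (A1 * D + D * A2); first by rewrite addr_gt0// mulr_gt0.
move=> t t0; have gg := log_grid_grid t 1 t0 (lexx 1).
have g0 n := log_grid_gt0 t 1 n t0.
have s0 n := tail_seq_ge0 beta t n hb t0.
have N0 : (0 <= seq_norm q (tail_seq beta t))%E by exact: seq_norm_ge0.
have P0 : (0 <= tail_norm q beta t)%E by exact: Lnorm_ge0.
have Dle n u : log_grid t 1 n < u <= log_grid t 1 (n + 1) ->
    beta u <= D * beta (log_grid t 1 n) /\ beta (log_grid t 1 n) <= D * beta u.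
  move=> nu; have u0 : 0 < u by apply: lt_trans (g0 n) _; have /andP[] := nu.
  have E : expR (1 * log_dist (log_grid t 1 n) u) <= expR 1.
    rewrite ler_expR mul1r; have := grid_log_dist _ _ _ _ gg nu.
    by rewrite expRK.
  split.
    apply: (le_trans (hC _ _ (g0 n) u0)).
    by rewrite ler_wpM2r ?(ltW (b0 _ _))// ler_wpM2l// ltW.
  apply: (le_trans (hC _ _ u0 (g0 n))).
  by rewrite ler_wpM2r ?(ltW (b0 _ _))// ler_wpM2l ?(ltW C0)// log_distC.
split.
- apply: (@le_trans _ _ (A1%:E * seq_norm q (fun n => (D * tail_seq beta t n)%R))%E).
    apply: (h1 _ _ _ _ gg) => //.
    + by move=> u /=; rewrite in_itv /= andbT; exact: lt_trans.
    + move=> u /=; rewrite in_itv /= andbT => tu.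
      by rewrite lee_fin mulr_ge0 ?powR_ge0// ltW// b0// (lt_trans t0).
    + by move=> n; rewrite mulr_ge0// ltW.
    + move=> n u /=; rewrite in_itv /= andbT => tu nu.
      rewrite lee_fin ler_wpM2l ?powR_ge0// /tail_seq.
      have [n0|n0] := leP 0 n; first by have [] := Dle n u nu.
      have /andP[_ un] := nu.
      have : log_grid t 1 (n + 1) <= log_grid t 1 0.
        by apply: (grid_le _ _ _ _ gg); rewrite lezD1.
      rewrite {2}/log_grid mulr0 expR0 mulr1 => h.
      by have := lt_le_trans tu (le_trans un h); rewrite ltxx.
  rewrite seq_normZ// muleA -EFinM lee_wpmul2r// lee_fin lerDl mulr_ge0// ltW//.
- apply: (@le_trans _ _ (D%:E * seq_norm q (fun n => (D^-1 * tail_seq beta t n)%R))%E).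
    rewrite -(seq_normZ q D)//; last by move=> n; rewrite mulr_ge0// invr_ge0 ltW.
    have -> // : (fun n => D * (D^-1 * tail_seq beta t n)) = tail_seq beta t.
    by apply/funext => n; rewrite mulVKf// lt0r_neq0.
  apply: (@le_trans _ _ (D%:E * (A2%:E * tail_norm q beta t))%E).
    rewrite lee_pmul2l//; apply: (h2 _ _ _ _ gg) => // [n|n u + nu].
      by rewrite mulr_ge0// invr_ge0 ltW.
    have u0 : 0 < u by apply: lt_trans (g0 n) _; have /andP[] := nu.
    rewrite /tail_seq; case: ifP => [n0 _|]; last by rewrite mulr0 ltxx.
    have tu : t < u.
      apply: le_lt_trans (proj1 (andP nu)).
      have : log_grid t 1 0 <= log_grid t 1 n by exact: (grid_le _ _ _ _ gg).
      by rewrite {1}/log_grid mulr0 expR0 mulr1.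
    rewrite /= in_itv /= andbT tu; split => //.
    rewrite lee_fin ler_wpM2l ?powR_ge0// ler_pdivrMl//.
    by have [] := Dle n u nu.
  by rewrite muleA -EFinM lee_wpmul2r// lee_fin lerDr mulr_ge0// ltW.
Qed.

Lemma log_dist_log_grid {R : realType} (s t : R) (n : int) : 0 < s -> 0 < t ->
  log_dist (log_grid s 1 n) (log_grid t 1 n) = log_dist s t.
Proof.
move=> s0 t0; rewrite /log_dist !ln_log_grid//; congr `|_|; ring.
Qed.

(** The grids started at s and at t are dilates of each other, so points with the same index keep
    the log distance of s and t. *)
Lemma tail_seq_slow {R : realType} (beta : R -> R) (e C : R) :
  (forall s t, 0 < s -> 0 < t -> beta t <= C * expR (e * log_dist s t) * beta s) ->
  forall s t n, 0 < s -> 0 < t ->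
    tail_seq beta t n <= C * expR (e * log_dist s t) * tail_seq beta s n.
Proof.
move=> hC s t n s0 t0; rewrite /tail_seq; case: ifP => [_|]; last by rewrite mulr0.
by rewrite -(log_dist_log_grid s t n s0 t0) hC// log_grid_gt0.
Qed.

(** Tail norms at two points are comparable through [tail_seq_slow]; this spreads finiteness from 1
    to all t and gives slow variation. The bound for beta is the term n = 0 of the discretised tail,
    and it also yields positivity. *)
Lemma tail_normP {R : realType} (q : \bar R) (beta : R -> R) :
  (0 < q)%E -> slow beta -> (tail_norm q beta 1 < +oo)%E ->
  [/\ forall t, 0 < t -> tail_norm q beta t = (fine (tail_norm q beta t))%:E,
      slow (fun t => fine (tail_norm q beta t)) &
      exists2 C : R, 0 < C &
        forall t, 0 < t -> beta t <= C * fine (tail_norm q beta t)].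
Proof.
move=> q0 hb fin1; have [b0 bS] := hb.
have [A A0 hA] := tail_norm_disc q beta q0 hb.
have P0 t : (0 <= tail_norm q beta t)%E by exact: Lnorm_ge0.
have s0 t n : 0 < t -> 0 <= tail_seq beta t n by exact: tail_seq_ge0.
(* Stated in the extended reals, because finiteness away from 1 is deduced from it. *)
have comp e : 0 < e -> exists2 E : R, 0 < E & forall s t, 0 < s -> 0 < t ->
    (tail_norm q beta t <= (E * expR (e * log_dist s t))%:E * tail_norm q beta s)%E.
  move=> e0; have [C C0 hC] := bS _ e0.
  have [E E0 hE] := seq_norm_le q 1 q0 ltr01.
  exists (A * (E * (C * A))); first by rewrite !mulr_gt0.
  move=> s t s1 t1; have [h1 _] := hA t t1; have [_ h2] := hA s s1.
  pose X := C * expR (e * log_dist s t).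
  have X0 : 0 < X by rewrite mulr_gt0// expR_gt0.
  apply: (le_trans h1).
  have -> : A * (E * (C * A)) * expR (e * log_dist s t) = A * (E * (X * A)).
    by rewrite /X; ring.
  rewrite EFinM -muleA lee_pmul2l//.
  apply: (@le_trans _ _ (E%:E * seq_norm q (fun n => (X * tail_seq beta s n)%R))%E).
    apply: hE => [n|n|n]; first exact: s0.
      by rewrite mulr_ge0 ?s0// ltW.
    by rewrite mul1r; exact: tail_seq_slow.
  rewrite seq_normZ// => [|n]; last exact: s0.
  by rewrite (EFinM E) -[leRHS]muleA lee_pmul2l// (EFinM X) -[leRHS]muleA lee_pmul2l.
have fin t : 0 < t -> tail_norm q beta t = (fine (tail_norm q beta t))%:E.
  move=> t0; rewrite fineK// ge0_fin_numE//.
  have [E E0 hE] := comp 1 ltr01.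
  apply: (le_lt_trans (hE 1 t ltr01 t0)).
  case: (tail_norm q beta 1) fin1 (P0 1) => // x _ _.
  by rewrite -EFinM ltry.
have bB t : 0 < t -> beta t <= A * fine (tail_norm q beta t).
  move=> t0; rewrite -lee_fin EFinM -fin//.
  have [_ h] := hA t t0; apply: le_trans h.
  have -> : beta t = tail_seq beta t 0.
    by rewrite /tail_seq lexx /log_grid mulr0 expR0 mulr1.
  apply: seq_norm_ge => // n; exact: s0.
split => //; last by exists A.
split=> [t t0|e e0].
  by rewrite -(pmulr_rgt0 _ A0) (lt_le_trans (b0 _ t0))// bB.
have [E E0 hE] := comp e e0; exists E => // s t s1 t1.
by have := hE s t s1 t1; rewrite (fin s)// (fin t)// -EFinM lee_fin.
Qed.

(* The quasi-norm of the space L, as a functional of psi(u) = u^(-sigma) a(u) K(u, f). *)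
Definition nested_norm {R : realType} (r : \bar R) (beta : R -> R) (q : \bar R)
    (psi : R -> R) : \bar R :=
  Lq_norm r `]0, +oo[ (fun s => ((s `^ (- recip r) * beta s)%:E *
    Lq_norm q `]0%R, s[ (fun u => (u `^ (- recip q) * psi u)%:E))%E).

(** The inner norm over ]0, s[ is at most a multiple of Z for s >= t and of Z (s/t)^d for s < t. By
    slow variation the outer contribution of s < t is controlled by beta t, so the tail beyond t
    dominates. *)
Lemma nested_norm_le {R : realType} (r q : \bar R) (beta : R -> R) (d : R) :
  (0 < r)%E -> (0 < q)%E -> 0 < d -> slow beta -> (tail_norm r beta 1 < +oo)%E ->
  exists2 A : R, 0 < A & forall t Z psi, 0 < t -> 0 < Z ->
    (forall u, 0 < u -> 0 <= psi u <= Z * expR (- (d * log_dist t u))) ->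
    (nested_norm r beta q psi <= (A * Z * fine (tail_norm r beta t))%:E)%E.
Proof.
move=> r0 q0 d0 hb fin1; have [b0 bS] := hb.
(* Half of the decay pays for the variation of beta, the other half is left for Hardy's
   inequality. *)
have d20 : 0 < d / 2 by rewrite divr_gt0.
have [C C0 hC] := bS _ d20.
have [fin _ _] := tail_normP r beta r0 hb fin1.
have [A1 A10 hA1] := Lq_norm_peak q d q0 d0.
have [A2 A20 hA2] := Lq_norm_le_seq r (expR 1) r0 (expR_gt0 1).
have [A3 A30 hA3] := tail_norm_disc r beta r0 hb.
pose D1 := A1 * (C * expR (d / 2)) * expR d.
have D10 : 0 < D1 by rewrite !mulr_gt0 ?expR_gt0.
pose D := D1 + D1 * C.
have D0 : 0 < D by rewrite addr_gt0// mulr_gt0.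
have [A4 A40 hA4] := seq_norm_hardy r (d / 2) D r0 d20 D0.
exists (A2 * (A4 * A3)); first by rewrite !mulr_gt0.
move=> t Z psi t0 Z0 hpsi.
have gg := log_grid_grid t 1 t0 (lexx 1).
have g0 n := log_grid_gt0 t 1 n t0.
pose low (s : R) := Num.min 0 (ln s - ln t).
have inner s : 0 < s -> (Lq_norm q `]0%R, s[ (fun u => (u `^ (- recip q) * psi u)%:E) <=
    (A1 * (Z * expR (d * low s)))%:E)%E.
  (* On ]0, s[ the bound is again a peak, now at min(s, t) and of height Z e^(d [low s]). *)
  move=> s0; apply: (hA1 _ _ (Num.min s t)).
  - by rewrite lt_min s0 t0.
  - by rewrite mulr_gt0// expR_gt0.
  - by move=> u /=; rewrite in_itv /= => /andP[].
  - move=> u /=; rewrite in_itv /= => /andP[u0 _].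
    by rewrite lee_fin mulr_ge0 ?powR_ge0//; have /andP[] := hpsi u u0.
  - move=> u /=; rewrite in_itv /= => /andP[u0 us].
    rewrite lee_fin ler_wpM2l ?powR_ge0//.
    have /andP[_ h] := hpsi u u0; apply: (le_trans h).
    rewrite -mulrA -expRD ler_pM2l// ler_expR /low.
    have [st|ts] := leP s t.
      have h1 : ln s <= ln t by rewrite ler_ln ?posrE.
      have h2 : ln u <= ln s by rewrite ler_ln ?posrE// ltW.
      rewrite min_r ?subr_le0// /log_dist !ler0_norm ?subr_le0//; last exact: le_trans h1.
      rewrite le_eqVlt; apply/orP; left; apply/eqP; ring.
    by rewrite min_l ?mulr0 ?add0r// subr_ge0 ler_ln ?posrE// ltW.
pose x (n : int) : R := D1 * (expR (d * Num.min 0 n%:~R) * beta (log_grid t 1 n)).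
have x0 n : 0 <= x n.
  by rewrite mulr_ge0 ?(ltW D10)// mulr_ge0 ?expR_ge0// ltW// b0.
apply: (@le_trans _ _ (A2%:E * seq_norm r (fun n => (Z * x n)%R))%E).
  apply: (hA2 _ _ _ _ gg).
  - by move=> s /=; rewrite in_itv /= andbT.
  - move=> s /=; rewrite in_itv /= andbT => s0.
    by rewrite mule_ge0 ?Lnorm_ge0// lee_fin mulr_ge0 ?powR_ge0// ltW// b0.
  - by move=> n; rewrite mulr_ge0// ltW.
  - move=> n s /=; rewrite in_itv /= andbT => s0 ns.
    have bs0 := b0 _ s0.
    apply: (@le_trans _ _ ((s `^ (- recip r) * beta s)%:E *
        (A1 * (Z * expR (d * low s)))%:E)%E).
      by rewrite lee_wpmul2l ?inner// lee_fin mulr_ge0 ?powR_ge0// ltW.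
    rewrite -EFinM lee_fin -mulrA ler_wpM2l ?powR_ge0//.
    have h1 : beta s <= C * expR (d / 2) * beta (log_grid t 1 n).
      apply: (le_trans (hC _ _ (g0 n) s0)); rewrite ler_wpM2r ?(ltW (b0 _ _))//.
      rewrite ler_pM2l// ler_expR ler_piMr ?(ltW d20)//.
      by have := grid_log_dist _ _ _ _ gg ns; rewrite expRK.
    have h2 : expR (d * low s) <= expR d * expR (d * Num.min 0 n%:~R).
      rewrite -expRD ler_expR -{2}[d]mulr1 -mulrDr ler_pM2l// /low.
      have /andP[_] := ns; rewrite -ler_ln ?posrE// ln_log_grid// intrD mulr1z mul1r => h.
      have h' : ln s - ln t <= n%:~R + 1 by move: h; lra.
      by case: (leP 0 n%:~R); case: (leP 0 (ln s - ln t)); lra.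
    have -> : beta s * (A1 * (Z * expR (d * low s))) =
        A1 * Z * (beta s * expR (d * low s)) by ring.
    have -> : Z * x n = A1 * Z * ((C * expR (d / 2) * beta (log_grid t 1 n)) *
        (expR d * expR (d * Num.min 0 n%:~R))) by rewrite /x /D1; ring.
    rewrite ler_pM2l ?mulr_gt0//.
    by apply: ler_pM; rewrite ?expR_ge0 ?(ltW bs0).
have h : (seq_norm r x <= A4%:E * seq_norm r (tail_seq beta t))%E.
  apply: hA4 => // [n|n M M0 hM]; first exact: tail_seq_ge0.
  have [n0|n0] := leP 0 n.
    have := hM 0; rewrite normr0 mulr0 oppr0 expR0 mul1r addr0 /tail_seq n0 => h.
    rewrite /x min_l ?ler0z// mulr0 expR0 mul1r /D mulrDl.
    apply: (@le_trans _ _ (D1 * M)); first by rewrite ler_pM2l.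
    by rewrite lerDl !mulr_ge0// ltW.
  (* For n < 0 the shift by -n leads to index 0, that is, to the value beta t. *)
  have := hM (- n); rewrite addrN /tail_seq lexx.
  have n0' : n%:~R < 0 :> R by rewrite ltrz0.
  rewrite mulrNz normrN ltr0_norm// {1}/log_grid mulr0 expR0 mulr1 => h.
  rewrite /x min_r ?(ltW n0')//.
  apply: (@le_trans _ _ (D1 * (C * M))); last first.
    by rewrite /D mulrDl -mulrA lerDr mulr_ge0// ltW.
  rewrite ler_pM2l//.
  apply: (@le_trans _ _ (expR (d * n%:~R) * (C * expR (d / 2 * (- n%:~R)) * beta t))).
    rewrite ler_pM2l ?expR_gt0//; apply: (le_trans (hC _ _ t0 (g0 n))).
    rewrite /log_dist ln_log_grid// addrAC subrr add0r mul1r ltr0_norm//.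
  rewrite -[C * _ * _]mulrA mulrCA ler_pM2l//; apply: le_trans h.
  rewrite mulrA -expRD ler_pM2r ?b0// ler_expR; lra.
rewrite seq_normZ//; have [h3 h4] := hA3 t t0.
rewrite (_ : A2 * (A4 * A3) * Z * _ =
  A2 * (Z * (A4 * (A3 * fine (tail_norm r beta t))))); last by ring.
rewrite EFinM lee_pmul2l// EFinM lee_pmul2l//; apply: (le_trans h).
by rewrite EFinM lee_pmul2l// EFinM -fin.
Qed.

(** For every s > t the inner norm sees ]t/e, t], where psi is at least X, hence it is at least a
    multiple of X. Restricting the outer norm to s > t leaves the tail of beta. *)
Lemma nested_norm_ge {R : realType} (r q : \bar R) (beta : R -> R) :
  (0 < r)%E -> (0 < q)%E -> slow beta -> (tail_norm r beta 1 < +oo)%E ->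
  exists2 A : R, 0 < A & forall t X psi, 0 < t -> 0 <= X ->
    (forall u, t * expR (- 1) < u <= t -> X <= psi u) ->
    ((X * fine (tail_norm r beta t))%:E <= A%:E * nested_norm r beta q psi)%E.
Proof.
move=> r0 q0 hb fin1; have [b0 bS] := hb.
have [C C0 hC] := bS _ ltr01.
have [fin _ _] := tail_normP r beta r0 hb fin1.
have [A1 A10 hA1] := seq_le_Lq_norm q (expR 1) q0.
have [A2 A20 hA2] := seq_le_Lq_norm r (expR 1) r0.
have [A3 A30 hA3] := tail_norm_disc r beta r0 hb.
pose D := C * expR 1.
have D0 : 0 < D by rewrite mulr_gt0 ?expR_gt0.
exists (A3 * A2 * (A1 * D)); first by rewrite !mulr_gt0.
move=> t X psi t0 X0 hX.
have N0 : (0 <= nested_norm r beta q psi)%E by exact: Lnorm_ge0.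
have [-> | Xn0] := eqVneq X 0.
  by rewrite mul0r mule_ge0// lee_fin ltW// !mulr_gt0.
have {}X0 : 0 < X by rewrite lt_neqAle eq_sym Xn0.
have gg := log_grid_grid t 1 t0 (lexx 1).
have g0 n := log_grid_gt0 t 1 n t0.
have inner s : t < s ->
    (X%:E <= A1%:E * Lq_norm q `]0%R, s[ (fun u => (u `^ (- recip q) * psi u)%:E))%E.
  (* The grid interval of index -1 is ]t/e, t]. *)
  move=> ts; pose x (n : int) : R := if n == -1 then X else 0.
  have x0 n : 0 <= x n by rewrite /x; case: ifP => // _; exact: ltW.
  apply: (@le_trans _ _ (seq_norm q x)).
    have -> : X = x (-1) by rewrite /x eqxx.
    exact: seq_norm_ge.
  apply: (hA1 _ _ _ _ gg) => // n u; rewrite /x.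
  case: eqP => [-> _|_]; last by rewrite ltxx.
  rewrite addNr /log_grid mulr0 expR0 mulr1 mul1r => /andP[tu ut].
  have u0 : 0 < u by apply: lt_trans tu; rewrite mulr_gt0// expR_gt0.
  rewrite /= in_itv /= u0 (le_lt_trans ut ts); split => //.
  by rewrite lee_fin ler_wpM2l ?powR_ge0// hX// ut andbT.
have [h1 _] := hA3 t t0.
rewrite EFinM -fin//.
apply: (@le_trans _ _ (X%:E * (A3%:E * seq_norm r (tail_seq beta t)))%E).
  by rewrite lee_pmul2l.
have s0 n : 0 <= tail_seq beta t n by exact: tail_seq_ge0.
pose Y := X / (A1 * D).
have Y0 : 0 < Y by rewrite divr_gt0// mulr_gt0.
have -> : X = A1 * D * Y by rewrite /Y mulrCA mulfV ?mulr1// gt_eqF// mulr_gt0.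
set N := seq_norm _ _; set P := nested_norm _ _ _ _.
have -> : ((A1 * D * Y)%:E * (A3%:E * N) = (A3 * (A1 * D))%:E * (Y%:E * N))%E.
  by rewrite muleA -EFinM muleA -EFinM; congr (_%:E * _)%E; ring.
have -> : ((A3 * A2 * (A1 * D))%:E * P = (A3 * (A1 * D))%:E * (A2%:E * P))%E.
  by rewrite muleA -EFinM; congr (_%:E * _)%E; ring.
rewrite lee_pmul2l ?lte_fin ?mulr_gt0// /N -seq_normZ//.
apply: (hA2 _ _ _ _ gg) => [n|n s + ns]; first by rewrite mulr_ge0// ltW.
rewrite /tail_seq; case: ifP => [n0 _|]; last by rewrite mulr0 ltxx.
have /andP[gs sg] := ns.
have s1 : 0 < s by exact: lt_trans gs.
have ts : t < s.
  apply: le_lt_trans gs.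
  have : log_grid t 1 0 <= log_grid t 1 n by exact: (grid_le _ _ _ _ gg).
  by rewrite {1}/log_grid mulr0 expR0 mulr1.
rewrite /= in_itv /= andbT s1; split => //.
have h2 : beta (log_grid t 1 n) <= D * beta s.
  apply: (le_trans (hC _ _ s1 (g0 n))); rewrite ler_wpM2r ?(ltW (b0 _ _))//.
  rewrite ler_pM2l// ler_expR mul1r log_distC.
  by have := grid_log_dist _ _ _ _ gg ns; rewrite expRK.
have h3 : ((X / A1)%:E <= Lq_norm q `]0%R, s[ (fun u => (u `^ (- recip q) * psi u)%:E))%E.
  by rewrite mulrC EFinM lee_pdivrMl// inner.
apply: (@le_trans _ _ ((s `^ (- recip r) * beta s)%:E * (X / A1)%:E)%E); last first.
  by rewrite lee_pmul2l ?lte_fin ?mulr_gt0 ?powR_gt0 ?b0.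
rewrite -EFinM lee_fin -[leRHS]mulrA ler_wpM2l ?powR_ge0//.
have -> : beta s * (X / A1) = Y * (D * beta s).
  by rewrite /Y invfM; field; rewrite !gt_eqF.
by rewrite ler_pM2l.
Qed.

(** * Exponents *)

Lemma log_distE {R : realType} (s t : R) : 0 < s -> s <= t ->
  log_dist s t = ln t - ln s.
Proof.
move=> s0 st; have t0 := lt_le_trans s0 st.
by rewrite /log_dist ger0_norm// subr_ge0 ler_ln ?posrE.
Qed.

Lemma slow_ln {R : realType} (b : R -> R) (e : R) : slow b -> 0 < e ->
  exists2 c : R, 0 < c & forall s t, 0 < s -> 0 < t ->
    `|ln (b t) - ln (b s)| <= e * log_dist s t + c.
Proof.
move=> [b0 bS] e0; have [C C0 hC] := bS _ e0.
exists (`|ln C| + 1) => [|s t s0 t0]; first by rewrite ltr_wpDl.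
have one x y : 0 < x -> 0 < y ->
    ln (b y) - ln (b x) <= e * log_dist x y + (`|ln C| + 1).
  move=> x0 y0; have := hC x y x0 y0.
  rewrite -ler_ln ?posrE ?mulr_gt0 ?expR_gt0 ?b0//.
  rewrite lnM ?posrE ?mulr_gt0 ?expR_gt0 ?b0// lnM ?posrE ?expR_gt0// expRK.
  have := ler_norm (ln C); lra.
rewrite ler_norml lerNl opprB one// andbT log_distC one//.
Qed.

Lemma quasi_power_slow {R : realType} (th e : R) (c1 : R -> R) : slow c1 -> 0 < e ->
  exists2 c : R, 0 < c &
    quasi_power c (th - e) (th + e) (fun t => t `^ th * (1 / c1 t)).
Proof.
move=> hc e0; have [c c0 h] := slow_ln c1 e hc e0; have [c10 _] := hc.
exists c => //; split=> [t t0|s t s0 st].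
  by rewrite mulr_gt0 ?powR_gt0// divr_gt0// c10.
have t0 := lt_le_trans s0 st.
rewrite !lnM ?posrE ?powR_gt0 ?divr_gt0 ?c10// ?invr_gt0 ?c10//.
rewrite !ln_powR !ln1 !lnV ?posrE ?c10//.
have := h s t s0 t0; rewrite log_distE//.
by rewrite ler_norml => /andP[]; lra.
Qed.

Lemma le_expR_trans {R : realType} (x y z P : R) : 0 <= P ->
  x <= P * expR y -> y <= z -> x <= P * expR z.
Proof. by move=> P0 xy yz; apply: (le_trans xy); rewrite ler_wpM2l// ler_expR. Qed.

(** To be applied to k = K(., f) and k1 = K(., f1), where f1 is the second part of a decomposition
    at t. To the right of t, k1 grows roughly like u^(theta theta1), to the left it decays like u.
    Multiplication by u^(-theta1) gives decay on both sides, since theta < 1 and theta1 < 1. The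
    height of the peak is M / w(t) times t^(-theta1) a1(t) = 1 / (rho(t) B(t)). *)
Lemma split_profile {R : realType} (theta theta1 C0 : R) (a a1 B : R -> R) :
  0 <= theta < 1 -> 0 < theta1 < 1 -> 0 < C0 -> slow a -> slow a1 -> slow B ->
  let rho := fun t => t `^ theta1 * (1 / (a1 t * B t)) in
  let w := fun t => rho t `^ (- theta) * a (rho t) in
  exists d del A : R, [/\ 0 < d, 0 < del, 0 < A &
    forall (t M : R) (k k1 : R -> R), 0 < t -> 0 < M ->
    (forall u, t <= u -> expR (- (d * (ln u - ln t))) * (w u * k u) <= M) ->
    (forall u, t <= u -> k1 u <= C0 * (M / w t + k u)) ->
    (forall u, 0 < u -> u <= t -> k1 u <= expR (ln u - ln t) * (C0 * (M / w t))) ->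
    forall u, 0 < u -> u `^ (- theta1) * a1 u * k1 u <=
      A * (M / (w t * rho t * B t)) * expR (- (del * log_dist t u))].
Proof.
move=> /andP[th0 th1] /andP[t10 t11] C00 ha ha1 hB rho w.
(* Both gaps (1 - theta) theta1 and 1 - theta1 are at least 10 e. Slow variation and d = e cost at
   most 5 e altogether, so the decay 5 e remains. *)
pose e := (1 - theta) * theta1 * (1 - theta1) / 10.
have thm : 0 < 1 - theta by rewrite subr_gt0.
have th1m : 0 < 1 - theta1 by rewrite subr_gt0.
have e0 : 0 < e by rewrite divr_gt0// !mulr_gt0.
have e1 : 10 * e <= (1 - theta) * theta1.
  rewrite /e mulrC divfK// ler_piMr ?mulr_ge0 ?(ltW thm) ?(ltW t10)//; lra.
have e2 : 10 * e <= 1 - theta1.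
  rewrite /e mulrC divfK// ler_piMl ?(ltW th1m)//.
  by rewrite mulr_ile1 ?(ltW thm) ?(ltW t10) ?(ltW t11)//; lra.
have te : e <= theta1.
  have : (1 - theta) * theta1 <= theta1 by rewrite ler_piMl ?(ltW t10)//; lra.
  lra.
have e11 : e <= 1 by lra.
have hc1 : slow (fun t => a1 t * B t) by exact: slow_mul.
have [cr cr0 [rho0 hrho]] := quasi_power_slow theta1 e _ hc1 e0.
have [ca ca0 hca] := slow_ln a e ha e0.
have [c1 c10 hc1'] := slow_ln a1 e ha1 e0.
have [cB cB0 hcB] := slow_ln B e hB e0.
have [a0 _] := ha; have [a10 _] := ha1; have [B0 _] := hB.
have w0 t : 0 < t -> 0 < w t.
  by move=> t0; rewrite mulr_gt0 ?powR_gt0 ?a0 ?rho0.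
have lw t : 0 < t -> ln (w t) = - theta * ln (rho t) + ln (a (rho t)).
  by move=> t0; rewrite lnM ?posrE ?powR_gt0 ?a0 ?rho0// ln_powR.
have lrho t : 0 < t -> ln (rho t) = theta1 * ln t - ln (a1 t) - ln (B t).
  move=> t0; have aB : 0 < a1 t * B t by rewrite mulr_gt0 ?a10 ?B0.
  rewrite /rho lnM ?posrE ?powR_gt0 ?divr_gt0// div1r lnV ?posrE// ln_powR.
  by rewrite lnM ?posrE ?a10 ?B0//; ring.
pose c' := e * cr + ca + cr.
pose A1 := 2 * C0 * expR (c' + cr + cB); pose A2 := C0 * expR c1.
exists e, (5 * e), (A1 + A2); split => //; first by rewrite mulr_gt0.
  by rewrite addr_gt0// !mulr_gt0 ?expR_gt0.
move=> t M k k1 t0 M0 hk hk1 hk2 u u0.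
set P := M / w t; set Q := M / _.
have P0 : 0 < P by rewrite divr_gt0 ?w0.
have Q0 : 0 < Q.
  rewrite divr_gt0//; apply: mulr_gt0; last exact: B0.
  by apply: mulr_gt0; [exact: w0|exact: rho0].
have PQ : P * expR (- ln (rho t) - ln (B t)) = Q.
  rewrite expRB expRN !lnK ?posrE ?rho0 ?B0// /P /Q.
  by field; rewrite !gt_eqF ?rho0 ?w0 ?B0.
have coef : u `^ (- theta1) * a1 u = expR (- theta1 * ln u + ln (a1 u)).
  by rewrite expRD lnK ?posrE ?a10// powR_expR.
have coef0 : 0 < u `^ (- theta1) * a1 u by rewrite coef expR_gt0.
have [tu|ut] := leP t u.
- have ltu : ln t <= ln u by rewrite ler_ln ?posrE.
  rewrite log_distE//.
  have /andP[R1 R2] := hrho t u t0 tu.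
  set l := ln u - ln t in R1 R2 *; have l0 : 0 <= l by rewrite subr_ge0.
  set Rr := ln (rho u) - ln (rho t).
  have el0 : 0 <= e * l by rewrite mulr_ge0// ltW.
  have Rlow : - cr <= Rr.
    have : 0 <= (theta1 - e) * l by rewrite mulr_ge0// subr_ge0.
    by rewrite /Rr; lra.
  have thR : - cr <= theta * Rr.
    have h1 := ler_wpM2l th0 Rlow.
    have h2 : theta * cr <= cr by rewrite ler_piMl ?ltW.
    lra.
  (* Exponent for k: e l from the hypothesis, theta Rr from the power of rho in 1/w, the rest from
     the variation of a along rho. It is nonnegative, so the constant term P is absorbed as well. *)
  pose E1 := e * l + theta * Rr + 2 * (e * l) + c'.
  have adiff : - (e * (2 * l + cr) + ca) <= ln (a (rho u)) - ln (a (rho t)).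
    have := hca _ _ (rho0 t t0) (rho0 u u0).
    rewrite ler_norml => /andP[h _]; apply: le_trans h.
    rewrite lerN2 lerD2r ler_wpM2l ?(ltW e0)// /log_dist -/Rr ler_norml.
    have h1 : theta1 * l <= l by rewrite ler_piMl ?(ltW t11).
    have h2 : e * l <= l by rewrite ler_piMl.
    by move: R2 Rlow; rewrite -/Rr => R2 Rlow; apply/andP; split; lra.
  have ku : k u <= P * expR E1.
    have h := hk u tu.
    have -> : P * expR E1 = M * expR (E1 - ln (w t)).
      by rewrite expRB lnK ?posrE ?w0// /P; ring.
    have h2 : k u <= M * expR (e * l - ln (w u)).
      rewrite expRB lnK ?posrE ?w0// mulrA ler_pdivlMr ?w0//.
      have -> : k u * w u = expR (e * l) * (expR (- (e * l)) * (w u * k u)).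
        by rewrite mulrA -expRD subrr expR0 mul1r mulrC.
      by rewrite [leRHS]mulrC ler_pM2l ?expR_gt0.
    apply: (le_expR_trans _ _ _ _ (ltW M0) h2).
    by rewrite !lw// /E1 /c'; move: adiff; rewrite /Rr; lra.
  have PE : P <= P * expR E1.
    rewrite ler_peMr ?(ltW P0)// -expR0 ler_expR /E1 /c'.
    have : 0 <= e * cr by rewrite mulr_ge0 ?ltW.
    lra.
  have k1u : k1 u <= 2 * C0 * (P * expR E1).
    apply: (le_trans (hk1 u tu)); rewrite -/P [2 * C0]mulrC -mulrA ler_pM2l//; lra.
  apply: (@le_trans _ _ ((u `^ (- theta1) * a1 u) * (2 * C0 * (P * expR E1)))).
    by rewrite ler_pM2l.
  have -> : u `^ (- theta1) * a1 u * (2 * C0 * (P * expR E1)) =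
      2 * C0 * Q * expR (E1 - Rr - (ln (B u) - ln (B t))).
    rewrite coef -PQ.
    (* The weight u^(-theta1) a1(u) is 1 / (rho(u) B(u)), which turns theta Rr into -(1 - theta)
       Rr. *)
    have -> : - theta1 * ln u + ln (a1 u) = - ln (rho u) - ln (B u).
      by rewrite lrho//; ring.
    have -> : E1 - Rr - (ln (B u) - ln (B t)) =
        (- ln (rho u) - ln (B u)) + E1 - (- ln (rho t) - ln (B t)).
      by rewrite /Rr; ring.
    set X := - ln (rho u) - ln (B u); set Y := - ln (rho t) - ln (B t).
    by rewrite (expRB (X + E1)) (expRD X); field; rewrite gt_eqF ?expR_gt0.
  apply: (@le_trans _ _ (A1 * Q * expR (- (5 * e * l)))); last first.
    rewrite ler_wpM2r ?expR_ge0// ler_wpM2r ?(ltW Q0)// lerDl.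
    by rewrite mulr_ge0 ?expR_ge0// ltW.
  have -> : A1 * Q * expR (- (5 * e * l)) =
      2 * C0 * Q * expR (c' + cr + cB - 5 * e * l).
    by rewrite expRD /A1; ring.
  have C2Q : 0 < 2 * C0 * Q by apply: mulr_gt0 => //; apply: mulr_gt0.
  rewrite (ler_pM2l C2Q) ler_expR.
  have Bd : - (e * l + cB) <= ln (B u) - ln (B t).
    have := hcB t u t0 u0.
    by rewrite log_distE// ler_norml => /andP[].
  have R3 : (1 - theta) * ((theta1 - e) * l - cr) <= (1 - theta) * Rr.
    by rewrite ler_wpM2l ?(ltW thm).
  have h1 : 10 * e * l <= (1 - theta) * theta1 * l by rewrite ler_wpM2r.
  have h2 : 0 <= theta * (e * l) by rewrite mulr_ge0.
  have h3 : 0 <= theta * cr by rewrite mulr_ge0// ltW.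
  rewrite /E1; lra.
(* To the left of t the linear decay of k1 beats u^(-theta1) by the margin 1 - theta1. *)
- have utl : ln u <= ln t by rewrite ler_ln ?posrE// ltW.
  rewrite log_distC log_distE ?(ltW ut)//.
  set l := ln t - ln u; have l0 : 0 <= l by rewrite subr_ge0.
  apply: (@le_trans _ _ ((u `^ (- theta1) * a1 u) * (expR (ln u - ln t) * (C0 * P)))).
    by rewrite ler_pM2l// hk2// ltW.
  apply: (@le_trans _ _ (A2 * Q * expR (- (5 * e * l)))); last first.
    rewrite ler_wpM2r ?expR_ge0// ler_wpM2r ?(ltW Q0)// lerDr.
    by rewrite !mulr_ge0 ?expR_ge0// ltW.
  have -> : u `^ (- theta1) * a1 u * (expR (ln u - ln t) * (C0 * P)) =
      C0 * P * expR (- theta1 * ln u + ln (a1 u) - l).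
    have -> : ln u - ln t = - l by rewrite /l opprB.
    rewrite coef; set X := - theta1 * ln u + ln (a1 u).
    by rewrite (expRD X); ring.
  have -> : A2 * Q * expR (- (5 * e * l)) =
      C0 * P * expR (c1 - ln (rho t) - ln (B t) - 5 * e * l).
    have -> : c1 - ln (rho t) - ln (B t) - 5 * e * l =
        (- ln (rho t) - ln (B t)) + (c1 + - (5 * e * l)) by ring.
    rewrite -PQ /A2; set Y := - ln (rho t) - ln (B t).
    by rewrite (expRD Y) (expRD c1); ring.
  rewrite (ler_pM2l (mulr_gt0 C00 P0)) ler_expR lrho//.
  have := hc1' t u t0 u0.
  rewrite log_distC log_distE ?(ltW ut)// -/l ler_norml => /andP[_ h].
  have h1 : 10 * e * l <= (1 - theta1) * l by rewrite ler_wpM2r.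
  have : 0 <= e * l by rewrite mulr_ge0// ltW.
  move: h h1; rewrite /l; lra.
Qed.

(** * K-functionals and reiteration *)

Section K_functional_theory.
Context {R : realType} {k : scalar_kind}.
Context {V : topologicalLmodType (scalar_field R k)}.
Implicit Types (X : qspace V) (f g h : V) (s t : R).

(** Separated from [is_quasinormed] because it is immediate for L, whose quasi-norm is [fine] of a
    nonnegative norm. *)
Definition qnorm_nonneg (X : qspace V) : Prop :=
  forall x, carrier X x -> 0 <= qnorm X x.

Let costs X0 X1 t f := [set s | exists f0 f1,
  [/\ carrier X0 f0, carrier X1 f1, f = f0 + f1 &
      s = qnorm X0 f0 + t * qnorm X1 f1]].

Let costs_ge0 X0 X1 t f : qnorm_nonneg X0 -> qnorm_nonneg X1 -> 0 <= t ->
  lbound (costs X0 X1 t f) 0.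
Proof.
move=> n0 n1 t0 _ [g [h [gX hX _ ->]]].
by rewrite addr_ge0 ?n0// mulr_ge0 ?n1.
Qed.

Lemma K_functional_le X0 X1 t g h : qnorm_nonneg X0 -> qnorm_nonneg X1 ->
  0 <= t -> carrier X0 g -> carrier X1 h ->
  K_functional X0 X1 t (g + h) <= qnorm X0 g + t * qnorm X1 h.
Proof.
move=> n0 n1 t0 gX hX; apply: ge_inf; first by exists 0; exact: costs_ge0.
by exists g, h.
Qed.

Lemma K_functional_glb X0 X1 t f y : sum_space X0 X1 f ->
  (forall g h, carrier X0 g -> carrier X1 h -> f = g + h ->
     y <= qnorm X0 g + t * qnorm X1 h) ->
  y <= K_functional X0 X1 t f.
Proof.
move=> [g [h [gX hX ->]]] hy; apply: lb_le_inf.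
  by exists (qnorm X0 g + t * qnorm X1 h), g, h.
by move=> _ [g' [h' [gX' hX' e ->]]]; exact: hy.
Qed.

Lemma K_functional_ge0 X0 X1 t f : qnorm_nonneg X0 -> qnorm_nonneg X1 ->
  0 <= t -> sum_space X0 X1 f -> 0 <= K_functional X0 X1 t f.
Proof.
move=> n0 n1 t0 fX; apply: K_functional_glb => // g h gX hX _.
by rewrite addr_ge0 ?n0// mulr_ge0 ?n1.
Qed.

Lemma K_functional_lt X0 X1 t f y : sum_space X0 X1 f ->
  K_functional X0 X1 t f < y ->
  exists g h, [/\ carrier X0 g, carrier X1 h, f = g + h &
    qnorm X0 g + t * qnorm X1 h < y].
Proof.
move=> fX Ky.
have : costs X0 X1 t f !=set0.
  by have [g [h [gX hX e]]] := fX; exists (qnorm X0 g + t * qnorm X1 h), g, h.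
move=> /inf_lt /(_ Ky) [_ [g [h [gX hX e ->]]] ?].
by exists g, h.
Qed.

(** The cost of a fixed decomposition at t is at most max(1, t/s) times its cost at s. The constants
    are the same for all couples and all f. *)
Lemma K_functional_log_lip X0 X1 f : qnorm_nonneg X0 -> qnorm_nonneg X1 ->
  sum_space X0 X1 f -> log_lip 1 1 (fun t => K_functional X0 X1 t f).
Proof.
move=> n0 n1 fX; split => [t t0|s t s0 t0].
  by apply: K_functional_ge0 => //; exact: ltW.
rewrite !mul1r; set E := expR _.
have E1 : 1 <= E by rewrite /E -expR0 ler_expR log_dist_ge0.
have Et : t <= E * s.
  rewrite -ler_ln ?posrE ?mulr_gt0 ?expR_gt0// lnM ?posrE ?expR_gt0// expRK.
  by rewrite -lerBlDr ler_norm.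
rewrite mulrC -ler_pdivrMr ?expR_gt0//.
apply: K_functional_glb => // g h gX hX ->.
rewrite ler_pdivrMr ?expR_gt0//.
apply: (le_trans (K_functional_le _ _ t _ _ n0 n1 (ltW t0) gX hX)).
rewrite mulrDl lerD ?ler_peMr ?n0// mulrAC ler_wpM2r ?n1//.
by rewrite mulrC.
Qed.

(** Add g to the X0 part of a decomposition of h. The maximum with 1 covers the X1 part, which is
    not multiplied by C. *)
Lemma K_functional_addl X0 X1 : is_quasinormed X0 -> qnorm_nonneg X1 ->
  exists2 C : R, 0 < C & forall t g h, 0 < t ->
    carrier X0 g -> sum_space X0 X1 h ->
    K_functional X0 X1 t (g + h) <= C * (qnorm X0 g + K_functional X0 X1 t h).
Proof.
move=> [[_ X0D _] n0 _ _ [C hC]] n1.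
pose C1 := Num.max C 1.
have C10 : 0 < C1 by rewrite lt_max ltr01 orbT.
exists C1 => // t g h t0 gX hX.
rewrite mulrC -ler_pdivrMr// -lerBlDl.
apply: K_functional_glb => // h0 h1 h0X h1X ->.
rewrite lerBlDl ler_pdivrMr// addrA.
apply: (le_trans (K_functional_le _ _ _ _ _ n0 n1 (ltW t0) (X0D _ _ gX h0X) h1X)).
rewrite addrA mulrDl lerD//.
  apply: (le_trans (hC _ _ gX h0X)); rewrite mulrC.
  by rewrite ler_wpM2l ?addr_ge0 ?n0// le_max lexx.
rewrite ler_peMr ?mulr_ge0 ?n1 ?(ltW t0)//.
by rewrite le_max lexx orbT.
Qed.

End K_functional_theory.

(** * Growth bounds for weights and the norms in logarithmic form *)

Lemma eq_Lq_norm {R : realType} (q : \bar R) (D : set R) (f g : R -> \bar R) :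
  (forall u, D u -> f u = g u) -> Lq_norm q D f = Lq_norm q D g.
Proof.
move=> fg; rewrite /Lq_norm; congr Lnorm; apply/funext => u.
by rewrite !patchE; case: ifPn => //; rewrite inE => /fg.
Qed.

Lemma log_lip_mul {R : realType} (C k C' k' : R) (F G : R -> R) :
  0 < C -> 0 < C' -> log_lip C k F -> log_lip C' k' G ->
  log_lip (C * C') (k + k') (fun t => F t * G t).
Proof.
move=> C0 C0' [F0 hF] [G0 hG]; split=> [t t0|s t s0 t0].
  by rewrite mulr_ge0 ?F0 ?G0.
rewrite mulrDl expRD.
have -> : C * C' * (expR (k * log_dist s t) * expR (k' * log_dist s t)) * (F s * G s)
  = (C * expR (k * log_dist s t) * F s) * (C' * expR (k' * log_dist s t) * G s) by ring.
by apply: ler_pM; rewrite ?F0 ?G0 ?hF ?hG.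
Qed.

Lemma log_lip_weaken {R : realType} (C k C' k' : R) (F : R -> R) :
  0 < C -> C <= C' -> k <= k' -> log_lip C k F -> log_lip C' k' F.
Proof.
move=> C0 CC kk [F0 hF]; split=> // s t s0 t0.
apply: (le_trans (hF s t s0 t0)); rewrite ler_wpM2r ?F0//.
apply: ler_pM; rewrite ?expR_ge0 ?(ltW C0)//.
by rewrite ler_expR ler_wpM2r// log_dist_ge0.
Qed.

Lemma log_lip_slow {R : realType} (b : R -> R) : slow b ->
  exists2 C : R, 0 < C & log_lip C 1 b.
Proof.
move=> [b0 bS]; have [C C0 hC] := bS 1 ltr01; exists C => //; split => // t t0.
by rewrite ltW// b0.
Qed.

Lemma log_lip_powR {R : realType} (x : R) : log_lip 1 `|x| (fun t => t `^ x).
Proof.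
split=> [t _|s t s0 t0]; first exact: powR_ge0.
rewrite mul1r !powR_expR// -expRD ler_expR -lerBlDr -mulrBr /log_dist -normrM.
exact: ler_norm.
Qed.

Lemma log_lip_comp {R : realType} (C k c k1 k2 : R) (F rho : R -> R) :
  0 < C -> 0 < k -> 0 < k1 -> 0 < k2 -> quasi_power c k1 k2 rho -> log_lip C k F ->
  log_lip (C * expR (k * c)) (k * k2) (F \o rho).
Proof.
move=> C0 k0 k10 k20 [rho0 hrho] [F0 hF]; split=> [t t0|s t s0 t0].
  by rewrite /= F0 ?rho0.
have rd : log_dist (rho s) (rho t) <= k2 * log_dist s t + c.
  have one x y : 0 < x -> x <= y -> log_dist (rho x) (rho y) <= k2 * log_dist x y + c.
    move=> x0 xy; have y0 := lt_le_trans x0 xy.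
    have /andP[h1 h2] := hrho _ _ x0 xy.
    have l0 : 0 <= ln y - ln x by rewrite subr_ge0 ler_ln ?posrE.
    rewrite [in leRHS]log_distE// /log_dist ler_norml; apply/andP; split; last by [].
    have : 0 <= k1 * (ln y - ln x) by rewrite mulr_ge0// ltW.
    have : 0 <= k2 * (ln y - ln x) by rewrite mulr_ge0// ltW.
    lra.
  have [st|ts] := leP s t; first exact: one.
  by rewrite log_distC [in leRHS]log_distC one// ltW.
apply: (le_trans (hF _ _ (rho0 _ s0) (rho0 _ t0))).
rewrite ler_wpM2r ?F0 ?rho0// -mulrA -expRD ler_wpM2l ?(ltW C0)// ler_expR.
by rewrite -mulrA -mulrDr addrC ler_wpM2l// ltW.
Qed.

Lemma powR_subr {R : realType} (u x y : R) : 0 < u ->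
  u `^ (- x - y) = u `^ (- y) * u `^ (- x).
Proof. by move=> u0; rewrite addrC powRD// (lt0r_neq0 u0) implybT. Qed.

Lemma interp_enormE {R : realType} {k : scalar_kind}
    {V : topologicalLmodType (scalar_field R k)} (X0 X1 : qspace V)
    (th : R) (q : \bar R) (b : R -> R) (f : V) :
  interp_enorm X0 X1 th q b f =
  dlog_norm q (fun u => u `^ (- th) * b u * K_functional X0 X1 u f).
Proof.
apply: eq_Lq_norm => u /=; rewrite in_itv /= andbT => u0.
by rewrite powR_subr//; congr EFin; ring.
Qed.

Lemma L_enormE {R : realType} {k : scalar_kind}
    {V : topologicalLmodType (scalar_field R k)} (X0 X1 : qspace V)
    (sigma : R) (r : \bar R) (b : R -> R) (q : \bar R) (a : R -> R) (f : V) :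
  L_enorm X0 X1 sigma r b q a f =
  nested_norm r (fun s => b s / a s) q
    (fun u => u `^ (- sigma) * a u * K_functional X0 X1 u f).
Proof.
apply: eq_Lq_norm => s _; congr (_ * _)%E.
apply: eq_Lq_norm => u /=; rewrite in_itv /= => /andP[u0 _].
by rewrite powR_subr//; congr EFin; ring.
Qed.

(** * Comparison of the K-functionals of (A0, A1) and (A0, L) *)

Section reiteration.
Context {R : realType} {k : scalar_kind}.
Context {V : topologicalLmodType (scalar_field R k)}.
Context (A0 A1 : qspace V) (theta1 theta : R) (q1 r1 : \bar R) (a a1 b1 : R -> R).
Context (hA0 : is_quasinormed A0) (hA1 : is_quasinormed A1).
Context (htheta1 : 0 < theta1 < 1) (htheta : 0 <= theta < 1).
Context (hq1 : (0 < q1)%E) (hr1 : (0 < r1)%E).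
Context (ha : slow a) (ha1 : slow a1) (hb1 : slow b1).

Let beta s := b1 s / a1 s.
Context (hfin : (tail_norm r1 beta 1 < +oo)%E).
Let B t := fine (tail_norm r1 beta t).
Let rho t := t `^ theta1 * (1 / (a1 t * B t)).
Let w t := rho t `^ (- theta) * a (rho t).
Let L := L_space A0 A1 theta1 r1 b1 q1 a1.

Let hbeta : slow beta.
Proof. by apply: slow_mul => //; exact: slow_inv. Qed.

Let hB : slow B.
Proof. by have [] := tail_normP r1 beta hr1 hbeta hfin. Qed.

Let n0 : qnorm_nonneg A0. Proof. by have [] := hA0. Qed.
Let n1 : qnorm_nonneg A1. Proof. by have [] := hA1. Qed.

Let nL : qnorm_nonneg L.
Proof. by move=> f _; rewrite fine_ge0// Lnorm_ge0. Qed.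

Let rho_gt0 t : 0 < t -> 0 < rho t.
Proof.
move=> t0; rewrite mulr_gt0 ?powR_gt0// divr_gt0// mulr_gt0//.
  by have [+ _] := ha1; apply.
by have [+ _] := hB; apply.
Qed.

Let w_gt0 t : 0 < t -> 0 < w t.
Proof.
move=> t0; rewrite mulr_gt0 ?powR_gt0 ?rho_gt0//.
by have [+ _] := ha; apply; exact: rho_gt0.
Qed.

Let L_sub f : carrier L f -> sum_space A0 A1 f.
Proof. by case. Qed.

(** The A0 part of a decomposition is absorbed by [K_functional_addl]. For h in L, [nested_norm_ge]
    bounds t^(-theta1) a1(t) B(t) K(t, h), which is K(t, h) / rho(t). *)
Lemma K_le_reiterated :
  exists2 C : R, 0 < C & forall t f, 0 < t -> sum_space A0 L f ->
    K_functional A0 A1 t f <= C * K_functional A0 L (rho t) f.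
Proof.
have [C C0 hC] := K_functional_addl A0 A1 hA0 n1.
have [A A0' hA] := nested_norm_ge r1 q1 beta hr1 hq1 hbeta hfin.
have [Ca Ca0 la] := log_lip_slow a1 ha1.
pose kk := `|- theta1| + 1 + 1.
pose D := Ca * expR kk.
have kk0 : 0 <= kk by rewrite !addr_ge0.
have D0 : 0 < D by rewrite mulr_gt0 ?expR_gt0.
exists (C * (1 + D * A)); first by rewrite mulr_gt0// addr_gt0// mulr_gt0.
move=> t f t0 fX.
have CD0 : 0 < C * (1 + D * A) by rewrite mulr_gt0// addr_gt0// mulr_gt0.
rewrite mulrC -ler_pdivrMr//.
apply: K_functional_glb => // g h gX hL ->.
have hX : sum_space A0 A1 h by exact: L_sub.
rewrite ler_pdivrMr//; apply: (le_trans (hC t g h t0 gX hX)).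
rewrite [leRHS]mulrC -mulrA ler_pM2l//.
have K0 : 0 <= K_functional A0 A1 t h by apply: K_functional_ge0 => //; exact: ltW.
suff Kh : K_functional A0 A1 t h <= D * A * (rho t * qnorm L h).
  rewrite mulrDl mul1r.
  have : 0 <= D * A * qnorm A0 g by rewrite mulr_ge0 ?n0// ltW// mulr_gt0.
  have : 0 <= rho t * qnorm L h by rewrite mulr_ge0 ?nL// ltW// rho_gt0.
  lra.
have psiL : log_lip (1 * Ca * 1) kk (fun u =>
    u `^ (- theta1) * a1 u * K_functional A0 A1 u h).
  apply: log_lip_mul => //; first by rewrite mul1r.
    by apply: log_lip_mul => //; exact: log_lip_powR.
  exact: K_functional_log_lip.
(* By [psiL] the weighted K-functional of h drops at most by the factor D on ]t/e, t], so X is a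
   lower bound there. *)
pose X := D^-1 * (t `^ (- theta1) * a1 t * K_functional A0 A1 t h).
have a1t : 0 < a1 t by have [+ _] := ha1; apply.
have Bt : 0 < B t by have [+ _] := hB; apply.
have X0 : 0 <= X by rewrite !mulr_ge0 ?invr_ge0 ?powR_ge0 ?(ltW D0)// ltW.
have := hA t X (fun u => u `^ (- theta1) * a1 u * K_functional A0 A1 u h) t0 X0.
have h1 u : t * expR (- 1) < u <= t ->
    X <= u `^ (- theta1) * a1 u * K_functional A0 A1 u h.
  move=> /andP[tu ut]; have u0 : 0 < u by apply: lt_trans tu; rewrite mulr_gt0// expR_gt0.
  rewrite /X ler_pdivrMl//; have [_ /(_ u t u0 t0)] := psiL.
  move/le_trans; apply; rewrite ler_wpM2r//.
    rewrite !mulr_ge0 ?powR_ge0 ?(K_functional_ge0 _ _ _ _ n0 n1 (ltW u0))// ltW//.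
    by have [+ _] := ha1; apply.
  rewrite mul1r mulr1 ler_wpM2l ?(ltW Ca0)// ler_expR ler_piMr//.
  rewrite log_distE//; move: tu; rewrite -ltr_ln ?posrE ?mulr_gt0 ?expR_gt0//.
  by rewrite ln_mul_expR//; lra.
move=> /(_ h1); rewrite -L_enormE.
have [_ Lh] := hL.
have -> : L_enorm A0 A1 theta1 r1 b1 q1 a1 h = (qnorm L h)%:E.
  by rewrite /= fineK// ge0_fin_numE ?Lnorm_ge0.
rewrite -EFinM lee_fin => hh.
have -> : K_functional A0 A1 t h = D * rho t * (X * B t).
  rewrite /X /rho powRN; field.
  by rewrite !gt_eqF ?powR_gt0.
have -> : D * A * (rho t * qnorm L h) = D * rho t * (A * qnorm L h) by ring.
by rewrite ler_wpM2l// mulr_ge0// ltW// rho_gt0.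
Qed.

(** A nearly optimal decomposition for (A0, A1) at t also serves (A0, L) at rho(t): [split_profile]
    shapes K(u, f1) into a peak and [nested_norm_le] bounds its L norm. This also shows that f1 lies
    in L. *)
Lemma reiterated_decomposition :
  exists d C : R, [/\ 0 < d, 0 < C & forall t M f, 0 < t -> 0 < M ->
    sum_space A0 A1 f ->
    (forall u, t <= u ->
      expR (- (d * (ln u - ln t))) * (w u * K_functional A0 A1 u f) <= M) ->
    exists g h, [/\ carrier A0 g, carrier L h, f = g + h &
      qnorm A0 g + rho t * qnorm L h <= C * (M / w t)]].
Proof.
have [C C0 hC] := K_functional_addl A0 A1 hA0 n1.
(* The modulus of -1 enters through f1 = -f0 + f; its absolute value is nonnegative without
   evaluating it for either scalar field. In [C1] the 2 covers u <= t. *)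
pose m := modulus (-1 : scalar_field R k).
pose C1 := 2 + C * (`|m| * 2 + 1).
have C10 : 0 < C1 by rewrite addr_gt0// mulr_gt0// ltr_wpDl// mulr_ge0.
have [d [del [A [d0 del0 A0' hA]]]] :=
  split_profile theta theta1 C1 a a1 B htheta htheta1 C10 ha ha1 hB.
have [A' A'0 hA'] := nested_norm_le r1 q1 beta del hr1 hq1 del0 hbeta hfin.
exists d, (2 + A' * A); split => //; first by rewrite addr_gt0// mulr_gt0.
move=> t M f t0 M0 fX hM.
have wt := w_gt0 t t0; have rt := rho_gt0 t t0.
have Bt : 0 < B t by have [+ _] := hB; apply.
pose P := M / w t; have P0 : 0 < P by rewrite divr_gt0.
have KP : K_functional A0 A1 t f <= P.
  have := hM t (lexx t); rewrite subrr mulr0 oppr0 expR0 mul1r.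
  by rewrite /P ler_pdivlMr// mulrC.
(* The infimum may not be attained; P > 0 makes 2P strictly larger than K(t, f). *)
have [|f0 [f1 [f0X f1X fE cost]]] := K_functional_lt A0 A1 t f (2 * P) fX.
  by apply: (le_lt_trans KP); lra.
have q0 := n0 f0 f0X; have q1' := n1 f1 f1X.
have tq1 : 0 <= t * qnorm A1 f1 by rewrite mulr_ge0// ltW.
have f1S : sum_space A0 A1 f1.
  have [[z _ _] _ _ _ _] := hA0.
  by exists 0, f1; split => //; rewrite add0r.
have K1up u : 0 < u -> K_functional A0 A1 u f1 <= u * qnorm A1 f1.
  move=> u0; have [[z _ _] _ z0 _ _] := hA0.
  have := K_functional_le A0 A1 u 0 f1 n0 n1 (ltW u0) z f1X.
  by rewrite add0r (proj2 (z0 0 z) erefl) add0r.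
have hk1 u : t <= u -> K_functional A0 A1 u f1 <=
    C1 * (M / w t + K_functional A0 A1 u f).
  move=> tu; have u0 := lt_le_trans t0 tu.
  have Ku : 0 <= K_functional A0 A1 u f by apply: K_functional_ge0 => //; exact: ltW.
  have [[_ _ sc] _ _ ho _] := hA0.
  have -> : f1 = (-1) *: f0 + f by rewrite fE scaleN1r addKr.
  apply: (le_trans (hC u _ _ u0 (sc _ _ f0X) fX)).
  rewrite ho// -/m -/P.
  have h1 : m * qnorm A0 f0 <= `|m| * (2 * P).
    apply: (@le_trans _ _ (`|m| * qnorm A0 f0)).
      by rewrite ler_wpM2r// ler_norm.
    by rewrite ler_wpM2l//; lra.
  apply: (@le_trans _ _ (C * (`|m| * (2 * P) + K_functional A0 A1 u f))).
    by rewrite ler_pM2l// lerD2r.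
  have h2 : 0 <= C * (`|m| * 2) * K_functional A0 A1 u f by rewrite !mulr_ge0// ltW.
  have h3 : 0 <= C * P by rewrite mulr_ge0 ?ltW.
  by rewrite /C1; lra.
have hk2 u : 0 < u -> u <= t -> K_functional A0 A1 u f1 <=
    expR (ln u - ln t) * (C1 * (M / w t)).
  move=> u0 ut; apply: (le_trans (K1up u u0)).
  rewrite expRB !lnK ?posrE// -/P.
  apply: (@le_trans _ _ (u / t * (2 * P))).
    by rewrite -mulrA ler_pM2l// ler_pdivlMl//; lra.
  by rewrite ler_pM2l ?divr_gt0// ler_pM2r// /C1 lerDl mulr_ge0 ?(ltW C0)//.
have prof := hA t M _ _ t0 M0 hM hk1 hk2.
pose Z := A * (M / (w t * rho t * B t)).
have Z0 : 0 < Z by rewrite mulr_gt0// divr_gt0// mulr_gt0// mulr_gt0.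
have := hA' t Z (fun u => u `^ (- theta1) * a1 u * K_functional A0 A1 u f1) t0 Z0.
have hpsi u : 0 < u -> 0 <= u `^ (- theta1) * a1 u * K_functional A0 A1 u f1
    <= Z * expR (- (del * log_dist t u)).
  move=> u0; apply/andP; split; last exact: prof.
  rewrite !mulr_ge0 ?powR_ge0 ?(K_functional_ge0 _ _ _ _ n0 n1 (ltW u0))// ltW//.
  by have [+ _] := ha1; apply.
move=> /(_ hpsi); rewrite -L_enormE => hL.
have f1L : carrier L f1 by split => //; apply: (le_lt_trans hL); exact: ltry.
exists f0, f1; split => //.
have Lf1 : qnorm L f1 <= A' * Z * B t.
  rewrite -lee_fin /= fineK// ge0_fin_numE ?Lnorm_ge0//.
  by have [] := f1L.
have e : rho t * (A' * Z * B t) = A' * A * P.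
  rewrite /Z /P; field.
  by rewrite (lt0r_neq0 wt) (lt0r_neq0 rt) (lt0r_neq0 Bt).
have : rho t * qnorm L f1 <= A' * A * P by rewrite -e ler_wpM2l// ltW.
rewrite -/P; lra.
Qed.

Context (r : \bar R) (hr : (0 < r)%E).

Let F f v := v `^ (- theta) * a v * K_functional A0 L v f.
Let G f t := w t * K_functional A0 A1 t f.

(** One set of constants for all f and for both F and G, since the norm comparisons fix their
    constants before the functions. *)
Let uniform_log_lip : exists C kk c k1 k2 : R,
  [/\ [/\ 0 < C, 0 < kk, 0 < c, 0 < k1 & 0 < k2], quasi_power c k1 k2 rho,
      forall f, sum_space A0 L f -> log_lip C kk (F f) &
      forall f, sum_space A0 A1 f -> log_lip C kk (G f)].
Proof.
have /andP[t10 t11] := htheta1.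
have e0 : 0 < theta1 / 2 by rewrite divr_gt0.
have [c c0 qp] := quasi_power_slow theta1 (theta1 / 2) _ (slow_mul _ _ ha1 hB) e0.
have k10 : 0 < theta1 - theta1 / 2 by lra.
have k20 : 0 < theta1 + theta1 / 2 by lra.
have [Ca Ca0 la] := log_lip_slow a ha.
pose v0 := `|- theta| + 1.
have v00 : 0 < v0 by rewrite ltr_wpDl.
have lv : log_lip (1 * Ca) v0 (fun v => v `^ (- theta) * a v).
  by apply: log_lip_mul => //; exact: log_lip_powR.
have Ca1 : 0 < 1 * Ca by rewrite mul1r.
have lw := log_lip_comp _ _ _ _ _ _ _ Ca1 v00 k10 k20 qp lv.
set Cw := 1 * Ca * expR _ in lw; set kw := v0 * _ in lw.
have Cw0 : 0 < Cw by rewrite mulr_gt0// expR_gt0.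
have kw0 : 0 < kw by rewrite mulr_gt0.
exists (Cw * 1 + 1 * Ca * 1), (kw + 1 + (v0 + 1)), c,
  (theta1 - theta1 / 2), (theta1 + theta1 / 2).
split => //.
- split=> //; first by rewrite !mulr1 addr_gt0.
  by apply: addr_gt0; [exact: addr_gt0|exact: (@addr_gt0 _ v0 1)].
- move=> f fX.
  apply: (@log_lip_weaken _ (1 * Ca * 1) (v0 + 1)).
  + by rewrite mulr1.
  + by rewrite lerDr mulr1 ltW.
  + by rewrite lerDr addr_ge0 ?ltW.
  + by apply: log_lip_mul => //; exact: K_functional_log_lip.
- move=> f fX.
  apply: (@log_lip_weaken _ (Cw * 1) (kw + 1)).
  + by rewrite mulr1.
  + by rewrite lerDl mulr1 ltW.
  + by rewrite lerDl addr_ge0 ?ltW.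
  + by apply: log_lip_mul => //; exact: K_functional_log_lip.
Qed.

Let sum_space_L f : sum_space A0 L f -> sum_space A0 A1 f.
Proof.
move=> [g [h [gX /L_sub [h0 [h1 [h0X h1X ->]]] ->]]].
have [[_ XD _] _ _ _ _] := hA0.
by exists (g + h0), h1; split; rewrite ?addrA//; exact: XD.
Qed.

(** Multiplied by w(t), the estimate of [K_le_reiterated] compares G at t with F at rho(t). *)
Lemma reiteration_norm_ge : exists2 A : R, 0 < A & forall f, sum_space A0 L f ->
  (dlog_norm r (G f) <= A%:E * dlog_norm r (F f))%E.
Proof.
have [C [kk [c [k1 [k2 [[C0 kk0 c0 k10 k20] qp lF lG]]]]]] := uniform_log_lip.
have [D D0 hD] := K_le_reiterated.
have [A A0' hA] := dlog_norm_le_comp r C kk D c k1 k2 hr C0 kk0 D0 c0 k10 k20.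
exists A => // f fX; apply: (hA _ _ _ qp (lF f fX) (lG f (sum_space_L _ fX))).
move=> t t0; rewrite /G /F.
have -> : D * (rho t `^ (- theta) * a (rho t) * K_functional A0 L (rho t) f) =
  w t * (D * K_functional A0 L (rho t) f) by rewrite /w; ring.
by rewrite ler_wpM2l ?hD// ltW// w_gt0.
Qed.

(** Membership in A0 + L comes first, because the growth bound for F depends on it. Then
    [reiterated_decomposition] supplies the hypothesis of Hardy's inequality. *)
Lemma reiteration_norm_le : exists2 A : R, 0 < A & forall f, sum_space A0 A1 f ->
  (dlog_norm r (G f) < +oo)%E ->
  sum_space A0 L f /\ (dlog_norm r (F f) <= A%:E * dlog_norm r (G f))%E.
Proof.
have [C [kk [c [k1 [k2 [[C0 kk0 c0 k10 k20] qp lF lG]]]]]] := uniform_log_lip.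
have [d [D [d0 D0 hD]]] := reiterated_decomposition.
have [A A0' hA] := dlog_norm_hardy r C kk D c k1 k2 d hr C0 kk0 D0 c0 k10 k20 d0.
have e1 : 1 < expR 1 :> R by rewrite expR_gt1.
have [E E0 hE] := dlog_norm_disc r C kk (expR 1) hr C0 kk0 e1.
exists A => // f fX finG.
have G0 : (0 <= dlog_norm r (G f))%E by exact: Lnorm_ge0.
have fXL : sum_space A0 L f.
  pose N := fine (dlog_norm r (G f)).
  have NE : dlog_norm r (G f) = N%:E by rewrite fineK// ge0_fin_numE.
  have N0 : 0 <= N by rewrite fine_ge0.
  (* A finite norm bounds G pointwise, by a grid through u. Hence a decomposition is available at t
     = 1; the 1 added to E N makes M positive. *)
  have GN u : 0 < u -> G f u <= E * N.
    move=> u0; have [_ h] := hE _ _ (log_grid_grid u 1 u0 (lexx 1)) (lG f fX).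
    rewrite -lee_fin (EFinM E N) -NE; apply: le_trans h.
    have -> : G f u = (G f \o log_grid u 1) 0.
      by rewrite /= /log_grid mulr0 expR0 mulr1.
    apply: seq_norm_ge => // n /=; have [+ _] := lG f fX; apply.
    exact: log_grid_gt0.
  have M0 : 0 < E * N + 1 by rewrite ltr_wpDl// mulr_ge0// ltW.
  have [|g [h [gX hX fE _]]] := hD 1 (E * N + 1) f ltr01 M0 fX; last by exists g, h.
  move=> u u1; have u0 : 0 < u by exact: lt_le_trans u1.
  have [Gf0 _] := lG f fX.
  apply: (@le_trans _ _ (G f u)).
    rewrite ler_piMl ?Gf0// expR_le1 oppr_le0 mulr_ge0 ?(ltW d0)//.
    by rewrite subr_ge0 ler_ln ?posrE.
  by rewrite (le_trans (GN u u0))// lerDl.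
split => //; apply: (hA _ _ _ qp (lF f fXL) (lG f fX)) => t M t0 M0 hM.
have [g [h [gX hX fE cost]]] := hD t M f t0 M0 fX hM.
rewrite /F -/(w t) fE.
apply: (@le_trans _ _ (w t * (D * (M / w t)))).
  rewrite ler_pM2l ?w_gt0//; apply: le_trans cost.
  by apply: K_functional_le => //; apply: ltW; exact: rho_gt0.
by rewrite [leLHS]mulrC -mulrA divfK ?lt0r_neq0 ?w_gt0.
Qed.

End reiteration.

(** * Equivalence of the two interpolation spaces *)

Theorem theorem15 (R : realType) (k : scalar_kind)
  (V : topologicalLmodType (scalar_field R k)) (A0 A1 : qspace V)
  (theta1 theta : R) (q1 r r1 : \bar R) (a a1 b1 : R -> R)
  (hA : compatible_couple A0 A1)
  (hA01 : carrier A0 `&` carrier A1 <> [set 0])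
  (htheta1 : 0 < theta1 < 1) (htheta : 0 <= theta < 1)
  (hq1 : (0 < q1)%E) (hr : (0 < r)%E) (hr1 : (0 < r1)%E)
  (ha : SV a) (ha1 : SV a1) (hb1 : SV b1)
  (hb1a1 : (Lq_norm r1 `]1%R, +oo[
              (fun s => (s `^ (- recip r1) * (b1 s / a1 s))%:E) < +oo)%E)
  (htheta0 : theta = 0 ->
     (Lq_norm r `]1%R, +oo[ (fun s => (s `^ (- recip r) * a s)%:E) < +oo)%E) :
  let c1 : R -> R := fun t =>
    a1 t * fine (Lq_norm r1 `]t, +oo[
                   (fun s => (s `^ (- recip r1) * (b1 s / a1 s))%:E)) in
  let rho : R -> R := fun t => t `^ theta1 * (1 / c1 t) in
  let eta : R := theta * theta1 in
  let asharp : R -> R := fun t => c1 t `^ theta * a (rho t) in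
  qspace_equiv
    (interp_space A0 (L_space A0 A1 theta1 r1 b1 q1 a1) theta r a)
    (interp_space A0 A1 eta r asharp).
Proof.
move=> c1 rho eta asharp.
have [_ [[qA0 _] _] [[qA1 _] _]] := hA.
have sa := SV_slow a ha; have sa1 := SV_slow a1 ha1; have sb1 := SV_slow b1 hb1.
have sbeta : slow (fun s => b1 s / a1 s) by apply: slow_mul => //; exact: slow_inv.
have c1_gt0 t : 0 < t -> 0 < c1 t.
  move=> t0; have [_ [hB _] _] := tail_normP r1 _ hr1 sbeta hb1a1.
  by rewrite mulr_gt0//; [have [+ _] := sa1; apply|exact: hB].
set L := L_space _ _ _ _ _ _ _.
(* Since rho^(-theta) = u^(-theta theta1) c1^theta, the weight of the target space is exactly w. *)
have GE f : interp_enorm A0 A1 eta r asharp f =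
    dlog_norm r (fun t => rho t `^ (- theta) * a (rho t) * K_functional A0 A1 t f).
  rewrite interp_enormE; apply: eq_Lq_norm => u /=; rewrite in_itv /= andbT => u0.
  congr (_ * (_ * _))%:E; rewrite /asharp mulrA; congr (_ * _).
  have cu := c1_gt0 u u0.
  rewrite /rho powRM ?powR_ge0 ?divr_ge0 ?(ltW cu)// -powRrM div1r.
  rewrite -(powR_inv1 (ltW cu)) -powRrM mulN1r opprK.
  by rewrite /eta mulrN mulrC mulrC [theta * _]mulrC.
have [C C0 hC] := reiteration_norm_ge A0 A1 theta1 theta q1 r1 a a1 b1 qA0 qA1
  htheta1 hq1 hr1 sa sa1 sb1 hb1a1 r hr.
have [D D0 hD] := reiteration_norm_le A0 A1 theta1 theta q1 r1 a a1 b1 qA0 qA1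
  htheta1 htheta hq1 hr1 sa sa1 sb1 hb1a1 r hr.
have LA f : sum_space A0 L f -> sum_space A0 A1 f.
  move=> [g [h [gX [[h0 [h1 [h0X h1X ->]]] _] ->]]].
  have [[_ XD _] _ _ _ _] := qA0.
  by exists (g + h0), h1; split; rewrite ?addrA//; exact: XD.
(* Finiteness of y matters because [fine] sends +oo to 0. *)
have fine_le (x y : \bar R) (c : R) : (0 <= x)%E -> (0 <= y)%E -> (y < +oo)%E ->
    (x <= c%:E * y)%E -> fine x <= c * fine y.
  move=> x0; case: y => [y| |] // y0 _; rewrite -EFinM.
  by case: x x0 => [x| |] //=; rewrite ?lee_fin ?leye_eq.
split; split.
- move=> f [fX ff]; split; first exact: LA.
  rewrite GE; apply: (le_lt_trans (hC f fX)); rewrite -interp_enormE.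
  by rewrite lte_mul_pinfty// ?lee_fin ltW.
- exists C => f [fX ff]; apply: fine_le => //; rewrite ?Lnorm_ge0//.
  by rewrite GE interp_enormE; exact: hC.
- move=> f [fX ff]; rewrite GE in ff; have [fL h] := hD f fX ff; split => //.
  rewrite interp_enormE; apply: (le_lt_trans h).
  by rewrite lte_mul_pinfty// ?lee_fin ltW.
- exists D => f [fX ff]; apply: fine_le => //; rewrite ?Lnorm_ge0//.
  rewrite GE in ff *; rewrite interp_enormE.
  by have [] := hD f fX ff.
Qed.
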